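(* Let the loss $\ell$ satisfy: $\|\nabla \ell(\mathbf{w},z)\|\le G$ for all $\mathbf{w}\in\mathbb{R}^p$ and all examples $z$; $\ell$ is bounded below by $\ell^\star$; and $\|\nabla\ell(\mathbf{w},z)-\nabla\ell(\mathbf{w}',z)\|\le L\|\mathbf{w}-\mathbf{w}'\|$ for all $\mathbf{w},\mathbf{w}'\in\mathbb{R}^p$ and all $z$. Suppose T-SGD is run for $T$ iterations on a dataset $S$ of $n$ i.i.d. samples from $\mathcal{P}$, with batch size $|B_t|=1$ for all $t\in[T]$ and cut parameter $\varepsilon\le\min\left(1,\frac{c'}{n}\right)$ for any $c'>0$. Then: 1. T-SGD with step size $\eta_t=O(1/\sqrt{T})$ has generalization error $$\operatorname{err}_{\mathrm{gen}}(\mathbf{w}_T)\le O\left(\frac{G^2T}{n}\right).$$ 2. T-SGD with step size $\eta_t=\frac{c}{t}$, for any $c>0$, has generalization error $$\operatorname{err}_{\mathrm{gen}}(\mathbf{w}_T)\le O\left(\frac{G^2\,T^{1-\frac{1}{Lc+1}}}{n}\right).$$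
   Context: $S=\{z_1,\dots,z_n\}$ is drawn i.i.d. from a distribution $\mathcal{P}$; $\mathcal{L}_S(\mathbf{w})=\frac1n\sum_{i=1}^n\ell(\mathbf{w},z_i)$ and $\mathcal{L}_{\mathcal{P}}(\mathbf{w})=\mathbb{E}_{z\sim\mathcal{P}}[\ell(\mathbf{w},z)]$. For the output $\mathbf{w}_T=\mathcal{A}(S)$ of a randomized algorithm $\mathcal{A}$, $\operatorname{err}_{\mathrm{gen}}(\mathbf{w}_T)=\mathbb{E}_{S,\mathcal{A}}[\mathcal{L}_S(\mathbf{w}_T)-\mathcal{L}_{\mathcal{P}}(\mathbf{w}_T)]$. T-SGD (Truncated SGD): from a fixed initial point $\mathbf{w}_0\in\mathbb{R}^p$ (not depending on the data), at each step draw, independently of the past, a mini-batch $B_t$ uniformly with replacement from $S$, compute $g(\mathbf{w}_t,B_t)=\frac1{|B_t|}\sum_{z_i\in B_t}\nabla\ell(\mathbf{w}_t,z_i)$, and update by $\mathbf{w}_{t+1}=\mathbf{w}_t-\eta_t\tilde{\mathbf{g}}_t$, where $[\tilde{\mathbf{g}}_t]_i=[g(\mathbf{w}_t,B_t)]_i$ if $|[g(\mathbf{w}_t,B_t)]_i|\ge\kappa_{\varepsilon,t}$ and $[\tilde{\mathbf{g}}_t]_i=0$ otherwise. $\mathbf{w}_T$ is the iterate after $T$ iterations. (Step sizes are indexed so that the $T$ updates use $\eta_1,\dots,\eta_T$ in order.) The threshold $\kappa_{\varepsilon,t}$ is determined from $\mathbf{g}=g(\mathbf{w}_t,B_t)$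 and $\varepsilon\in[0,1]$: sort $[\mathbf{g}]_{(1)}^2\ge\dots\ge[\mathbf{g}]_{(p)}^2$; let $i\in\{1,\dots,p\}$ be the smallest index with $\sum_{j<i}[\mathbf{g}]_{(j)}^2\ge(1-\varepsilon^2)\|\mathbf{g}\|^2$ and put $\kappa_{\varepsilon,t}=|[\mathbf{g}]_{(i)}|$ (if no such $i$ exists, $\kappa_{\varepsilon,t}=0$). Consequently $\|\tilde{\mathbf{g}}_t\|^2\ge(1-\varepsilon^2)\|g(\mathbf{w}_t,B_t)\|^2$. $O(\cdot)$ hides constant factors not depending on $T$ or $n$ (they may depend on $L$, on the step-size constant and on $c'$).
   Formalization: The constant hidden in the O of part 1 is allowed to depend on the dimension p (a dimension-free constant is impossible there), and the smoothness constant L is assumed positive (part 2 fails for L = 0). *)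

(* Defs.v *)
From HB Require Import structures.
From mathcomp Require Export all_boot all_order all_algebra.
From mathcomp Require Export all_classical all_reals all_analysis.
Export Order.TTheory GRing.Theory Num.Theory.
Export numFieldNormedType.Exports.

Set Implicit Arguments.
Unset Strict Implicit.
Unset Printing Implicit Defensive.

Local Open Scope classical_set_scope.
Local Open Scope ring_scope.

(* The library norm on 'rV[R]_p is the sup norm; gradients and parameters are
   measured here in the Euclidean norm. *)
Definition norm2 (R : realType) (p : nat) (v : 'rV[R]_p) : R :=
  Num.sqrt (\sum_(i < p) v 0 i ^+ 2).

Definition grad (R : realType) (p : nat) (f : 'rV[R]_p -> R) (w : 'rV[R]_p) :
    'rV[R]_p :=
  \row_(i < p) 'D_(delta_mx 0 i : 'rV[R]_p) f w.

Definition loss_assumptions (R : realType) (p : nat) (d : measure_display)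
    (Z : measurableType d) (l : 'rV[R]_p -> Z -> R) (G L lstar : R) : Prop :=
  [/\ forall w, measurable_fun [set: Z] (l w),
      forall z w, differentiable (l^~ z) w,
      forall z w, norm2 (grad (l^~ z) w) <= G,
      forall z w, lstar <= l w z &
      forall z w w',
        norm2 (grad (l^~ z) w - grad (l^~ z) w') <= L * norm2 (w - w')].

(* With s the coordinates' absolute values in decreasing order (so that
   s`_k is |g|_(k+1)), k below is the 0-based version of the smallest index i;
   if there is none then k = p, and s`_p = 0. *)
Definition cut_threshold (R : realType) (p : nat) (eps : R) (g : 'rV[R]_p) : R :=
  let s := sort (fun x y : R => y <= x) [seq `|g 0 i| | i <- enum 'I_p] in
  let k := find (fun k : nat =>
    (1 - eps ^+ 2) * norm2 g ^+ 2 <= \sum_(0 <= j < k) s`_j ^+ 2) (iota 0 p) in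
  s`_k.

Definition truncate (R : realType) (p : nat) (eps : R) (g : 'rV[R]_p) :
    'rV[R]_p :=
  \row_(i < p) if cut_threshold eps g <= `|g 0 i| then g 0 i else 0.

(* A batch is given by the list of the indices of its examples in the data
   set, since sampling with replacement may repeat an example. *)
Definition batch_grad (R : realType) (p n : nat) (Z : Type)
    (l : 'rV[R]_p -> Z -> R) (S : 'I_n -> Z) (w : 'rV[R]_p)
    (B : seq 'I_n) : 'rV[R]_p :=
  (size B)%:R^-1 *: \sum_(i <- B) grad (l^~ (S i)) w.

(* The update leading from w_t to w_(t+1) uses the step size eta_(t+1). *)
Fixpoint tsgd (R : realType) (p n : nat) (Z : Type) (l : 'rV[R]_p -> Z -> R)
    (eps : R) (eta : nat -> R) (w0 : 'rV[R]_p) (S : 'I_n -> Z)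
    (B : nat -> seq 'I_n) (t : nat) {struct t} : 'rV[R]_p :=
  if t is t'.+1 then
    let w := tsgd l eps eta w0 S B t' in
    w - eta t'.+1 *: truncate eps (batch_grad l S w (B t'))
  else w0.

Definition empirical_loss (R : realType) (p n : nat) (Z : Type)
    (l : 'rV[R]_p -> Z -> R) (S : 'I_n -> Z) (w : 'rV[R]_p) : R :=
  n%:R^-1 * \sum_(i < n) l w (S i).

(* Extended-real valued: a loss bounded below has a well-defined expectation,
   which may be +oo. *)
Definition population_loss (R : realType) (p : nat) (d : measure_display)
    (Z : measurableType d) (l : 'rV[R]_p -> Z -> R) (P : probability Z R)
    (w : 'rV[R]_p) : \bar R :=
  'E_P[l w].

(* Omega carries both the data set S and the randomness of the algorithm. *)
Definition err_gen (R : realType) (p n : nat) (d d' : measure_display)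
    (Z : measurableType d) (Omega : measurableType d')
    (l : 'rV[R]_p -> Z -> R) (P : probability Z R) (Pr : probability Omega R)
    (S : 'I_n -> Omega -> Z) (W : Omega -> 'rV[R]_p) : \bar R :=
  (\int[Pr]_omega
     ((empirical_loss l (S^~ omega) (W omega))%:E
      - population_loss l P (W omega)))%E.

Definition mutually_independent (R : realType) (d : measure_display)
    (Omega : measurableType d) (Pr : probability Omega R) (I : finType)
    (F : I -> set (set Omega)) : Prop :=
  (forall i, F i `<=` measurable) /\
  (forall (J : {set I}) (E : I -> set Omega),
    (forall i, i \in J -> F i (E i)) ->
    Pr (\bigcap_(i in [set i | i \in J]) E i) = (\prod_(i in J) Pr (E i))%E).

(* The events generated by the n examples and by the first T batches. *)
Definition sampling_events (n b T : nat) (d d' : measure_display)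
    (Z : measurableType d) (Omega : measurableType d')
    (S : 'I_n -> Omega -> Z) (B : nat -> Omega -> b.-tuple 'I_n)
    (i : 'I_n + 'I_T) : set (set Omega) :=
  match i with
  | inl j => [set S j @^-1` A | A in (measurable : set (set Z))]
  | inr t => [set B t @^-1` A | A in [set: set (b.-tuple 'I_n)]]
  end.

Definition tsgd_sampling (R : realType) (n b T : nat) (d d' : measure_display)
    (Z : measurableType d) (Omega : measurableType d')
    (P : probability Z R) (Pr : probability Omega R)
    (S : 'I_n -> {RV Pr >-> Z}) (B : nat -> Omega -> b.-tuple 'I_n) : Prop :=
  [/\ forall (i : 'I_n) (A : set Z), measurable A ->
        distribution Pr (S i) A = P A,
      forall (t : 'I_T) (beta : b.-tuple 'I_n),
        Pr (B t @^-1` [set beta]) = (#|{: b.-tuple 'I_n}|%:R^-1)%:E &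
      mutually_independent Pr (@sampling_events n b T d d' Z Omega S B)].

(* Main.v *)
From mathcomp Require Import ring lra zify perm measurable_realfun.
Require Import Defs.

(* Fix the drawn indices. Replacing the example j by a constant in the run gives
   a path independent of S j, along which the centered loss of S j has mean 0;
   so S j contributes at most a Lipschitz constant times the distance between
   the two paths, and nothing if it is never drawn.
   For eta_t <= c / sqrt T the path stays within r = c G sqrt T of w0. The at
   most T drawn examples contribute at most the supremum, over a cube of
   half-side r in R^p, of a sum of at most T independent centered 2G-Lipschitz
   fields, divided by n. Chaining along dyadic nets bounds its mean by
   O(G r sqrt T) = O(G^2 T), with a constant depending on p.
   For eta_t = c / t the expected distance between the two paths is bounded by
   O(G T^(1 - 1/(Lc+1)) / n), by halving T repeatedly. *)

Set Implicit Arguments.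
Unset Strict Implicit.
Unset Printing Implicit Defensive.

Local Open Scope classical_set_scope.
Local Open Scope ring_scope.

(** * Euclidean norm and gradients *)

(** At step size c / sqrt T, treating the examples one at a time is too weak: an example is drawn
    with probability at most T / n and may then move the path by order r, which only gives G^2
    T^(3/2) / n. The missing factor sqrt T is the cancellation between independent drawn examples;
    but the last iterate depends on all of them, hence the supremum over a region that contains
    every path. Fixing the draws, an event independent of the data, makes the set of drawn examples
    deterministic. At step size c / t the obstacle is the discontinuity of truncation: even with
    equal examples, a step separates two paths by an extra 2 G eps eta. Since eps <= c' / n, this
    has the same order as the mean effect of drawing the replaced example. The loss may be unbounded
    in z, so the estimates are made for l(w, z) - l(w0, z) minus its mean, whence the Lipschitz
    constant 2G; the part at w0 has mean 0 because w0 is fixed. If the loss is not integrable, the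
    population loss is +oo everywhere and the error is -oo. *)

Section norm2.
Context {R : realType} {p : nat}.
Implicit Types u v w : 'rV[R]_p.

Lemma norm2_ge0 v : 0 <= norm2 v.
Proof. exact: sqrtr_ge0. Qed.

Lemma sqr_norm2 v : norm2 v ^+ 2 = \sum_(i < p) v 0 i ^+ 2.
Proof. by rewrite sqr_sqrtr// sumr_ge0// => i _; exact: sqr_ge0. Qed.

Lemma coord_le_norm2 v i : `|v 0 i| <= norm2 v.
Proof.
rewrite -sqrtr_sqr ler_wsqrtr// (bigD1 i)//= lerDl sumr_ge0// => j _.
exact: sqr_ge0.
Qed.

Lemma norm2_eq0 v : norm2 v = 0 -> v = 0.
Proof.
move=> v0; apply/rowP => i; apply/eqP; rewrite mxE -normr_le0 -v0.
exact: coord_le_norm2.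
Qed.

(** Expand the nonnegative sum of (|v| u_i - |u| v_i)^2, which equals 2 |u| |v| (|u| |v| - <u,
    v>). *)
Lemma norm2_cauchy_schwarz u v :
  \sum_(i < p) u 0 i * v 0 i <= norm2 u * norm2 v.
Proof.
have [u0|un0] := eqVneq (norm2 u) 0.
  rewrite u0 mul0r (norm2_eq0 u0) big1// => i _; by rewrite mxE mul0r.
have [v0|vn0] := eqVneq (norm2 v) 0.
  rewrite v0 mulr0 (norm2_eq0 v0) big1// => i _; by rewrite mxE mulr0.
have uv_gt0 : 0 < norm2 u * norm2 v by rewrite mulr_gt0// lt0r norm2_ge0 andbT.
have : 0 <= \sum_(i < p) (norm2 v * u 0 i - norm2 u * v 0 i) ^+ 2.
  by apply: sumr_ge0 => i _; exact: sqr_ge0.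
have -> : \sum_(i < p) (norm2 v * u 0 i - norm2 u * v 0 i) ^+ 2 =
    2 * (norm2 u * norm2 v) * (norm2 u * norm2 v - \sum_(i < p) u 0 i * v 0 i).
  transitivity (norm2 v ^+ 2 * (\sum_(i < p) u 0 i ^+ 2)
      + norm2 u ^+ 2 * (\sum_(i < p) v 0 i ^+ 2)
      - 2 * (norm2 u * norm2 v) * \sum_(i < p) u 0 i * v 0 i).
    rewrite !mulr_sumr -big_split/= -sumrB.
    by apply: eq_bigr => i _; ring.
  by rewrite -!sqr_norm2; ring.
by rewrite pmulr_rge0 ?subr_ge0// mulr_gt0.
Qed.

Lemma norm2D u v : norm2 (u + v) <= norm2 u + norm2 v.
Proof.
rewrite -(ler_pXn2r (n := 2))// ?nnegrE ?addr_ge0 ?norm2_ge0//.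
have -> : norm2 (u + v) ^+ 2 =
    norm2 u ^+ 2 + (\sum_(i < p) u 0 i * v 0 i) *+ 2 + norm2 v ^+ 2.
  rewrite !sqr_norm2 -sumrMnl -!big_split/=.
  by apply: eq_bigr => i _; rewrite mxE sqrrD.
by rewrite sqrrD lerD2r lerD2l lerMn2r norm2_cauchy_schwarz orbT.
Qed.

Lemma norm2Z (a : R) v : norm2 (a *: v) = `|a| * norm2 v.
Proof.
rewrite /norm2 -sqrtr_sqr -sqrtrM ?sqr_ge0//; congr Num.sqrt.
by rewrite mulr_sumr; apply: eq_bigr => i _; rewrite mxE exprMn.
Qed.

Lemma norm2N v : norm2 (- v) = norm2 v.
Proof. by rewrite -scaleN1r norm2Z normrN normr1 mul1r. Qed.

Lemma norm2B u v : norm2 (u - v) <= norm2 u + norm2 v.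
Proof. by rewrite (le_trans (norm2D _ _))// norm2N. Qed.

Lemma norm2_distC u v : norm2 (u - v) = norm2 (v - u).
Proof. by rewrite -norm2N opprB. Qed.

Lemma norm2_0 : norm2 (0 : 'rV[R]_p) = 0.
Proof. by rewrite -(scale0r 0) norm2Z normr0 mul0r. Qed.

(** The crude factor p + 1 in place of sqrt p stays positive for p = 0, so that the scales used in
    chaining are positive too. *)
Lemma norm2_le_coord (a : R) v :
  0 <= a -> (forall i, `|v 0 i| <= a) -> norm2 v <= p.+1%:R * a.
Proof.
move=> a0 va; rewrite -(ler_pXn2r (n := 2))// ?nnegrE ?norm2_ge0 ?mulr_ge0//.
rewrite sqr_norm2 exprMn (@le_trans _ _ (\sum_(i < p) a ^+ 2))//.
  apply: ler_sum => i _; rewrite -[leLHS]real_normK ?num_real//.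
  by rewrite ler_pXn2r ?nnegrE.
rewrite sumr_const card_ord -[_ *+ p]mulr_natl ler_wpM2r ?sqr_ge0//.
by rewrite -natrX ler_nat (@leq_trans p.+1)// expnS leq_pmulr// expn1.
Qed.

End norm2.

Lemma diff_grad {R : realType} {p : nat} (f : 'rV[R]_p -> R) (w v : 'rV[R]_p) :
  differentiable f w -> 'd f w v = \sum_(i < p) grad f w 0 i * v 0 i.
Proof.
move=> df; rewrite {1}(row_sum_delta v) linear_sum; apply: eq_bigr => i _.
by rewrite linearZ /= -deriveE// mxE mulrC.
Qed.

(** Mean value theorem on the segment from [w'] to [w], then Cauchy-Schwarz. *)
Lemma bounded_grad_lipschitz {R : realType} {p : nat} (f : 'rV[R]_p -> R)
    (G : R) (w w' : 'rV[R]_p) :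
  (forall v, differentiable f v) -> (forall v, norm2 (grad f v) <= G) ->
  `|f w - f w'| <= G * norm2 (w - w').
Proof.
move=> df fG.
suff H u u' : f u - f u' <= G * norm2 (u - u').
  by rewrite ler_norml H andbT lerNl opprB norm2_distC H.
pose g (t : R) := u' + t *: (u - u').
have dg t : differentiable g t.
  by apply: differentiableD => //; exact: differentiableZl.
have gE t : 'd g t 1 = u - u'.
  have dg' : is_diff t g (0 + *:%R^~ (u - u')) by exact: is_diffD.
  by rewrite (@diff_val _ _ _ _ _ _ _ dg')/= add0r scale1r.
have dfg (t : R) : is_derive t 1 (f \o g)
    (\sum_(i < p) grad f (g t) 0 i * (u - u') 0 i).
  have dt : differentiable (f \o g) t by exact: differentiable_comp.
  apply: DeriveDef; first exact: diff_derivable.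
  by rewrite deriveE// diff_comp//= gE diff_grad.
have cfg : {within `[0, 1], continuous (f \o g)}.
  apply: continuous_subspaceT => t.
  by apply: differentiable_continuous; exact: differentiable_comp.
have [t _] := MVT_segment ler01 (fun t _ => dfg t) cfg.
rewrite /g/= scale0r scale1r addr0 [u' + _]addrC subrK subr0 mulr1 => ->.
by rewrite (le_trans (norm2_cauchy_schwarz _ _))// ler_wpM2r// norm2_ge0.
Qed.

(** * Truncation *)

Definition decr_abs {R : realType} {p : nat} (g : 'rV[R]_p) : seq R :=
  sort (fun x y : R => y <= x) [seq `|g 0 i| | i <- enum 'I_p].

Lemma size_decr_abs {R : realType} {p : nat} (g : 'rV[R]_p) :
  size (decr_abs g) = p.
Proof. by rewrite size_sort size_map size_enum_ord. Qed.

Lemma ge_total {R : realType} : total (fun x y : R => y <= x).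
Proof. by move=> x y; exact: le_total. Qed.

Lemma ge_trans {R : realType} : transitive (fun x y : R => y <= x).
Proof. by move=> x y z yx xz; exact: le_trans xz yx. Qed.

Lemma sorted_decr_abs {R : realType} {p : nat} (g : 'rV[R]_p) :
  sorted (fun x y : R => y <= x) (decr_abs g).
Proof. by apply: sort_sorted; exact: ge_total. Qed.

Lemma nth_decr_le {R : realType} (s : seq R) (j k : nat) :
  sorted (fun x y : R => y <= x) s -> (j <= k)%N -> (k < size s)%N ->
  s`_k <= s`_j.
Proof.
move=> ss jk ks.
by apply: (sorted_leq_nth ge_trans _ _ ss) => //;
   rewrite ?inE// (leq_ltn_trans jk).
Qed.

(** Turns a condition on an order statistic into a count of entries, whose measurability is
    plain. *)
Lemma nth_decr_leE {R : realType} (s : seq R) (k : nat) (a : R) :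
  sorted (fun x y : R => y <= x) s -> (k < size s)%N ->
  (s`_k <= a) = (count (fun x => (a < x)%R) s <= k)%N.
Proof.
move=> ss ks; apply/idP/idP => [ska|].
  rewrite -(cat_take_drop k s) count_cat -[leqRHS]addn0 leq_add//.
    by rewrite (leq_trans (count_size _ _))// size_take ks.
  rewrite leqNgt -has_count; apply/negP => /hasP[x].
  case/(nthP 0) => i; rewrite size_drop nth_drop => iks <-; apply/negP.
  rewrite -leNgt (le_trans _ ska)// nth_decr_le ?leq_addr//.
  by rewrite -ltn_subRL.
apply: contraTT; rewrite -ltNge -ltnNge => ask.
rewrite -(cat_take_drop k.+1 s) count_cat ltn_addr//.
have -> : count (fun x => a < x) (take k.+1 s) = k.+1.
  rewrite -[RHS](@size_takel k.+1 _ s)//; apply/eqP; rewrite -all_count.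
  apply/allP => x /(nthP 0)[i]; rewrite size_takel// => ik.
  rewrite nth_take// => <-; rewrite (lt_le_trans ask)//.
  exact: nth_decr_le.
by [].
Qed.

Section truncation.
Context {R : realType} {p : nat}.
Implicit Types (g : 'rV[R]_p) (eps : R).

Lemma sum_decr_abs g (P : pred R) :
  \sum_(i < p | P `|g 0 i|) g 0 i ^+ 2 =
  \sum_(x <- decr_abs g | P x) x ^+ 2.
Proof.
rewrite (perm_big _ (permEl (perm_sort _ _)))/= big_map.
rewrite big_enum_cond/=; apply: eq_big => // i _.
by rewrite real_normK ?num_real.
Qed.

(** The entries sorted before the cut index are at least the threshold, hence kept, and by the
    choice of that index they already carry the required mass. *)
Lemma truncated_mass_ge g eps : 0 <= eps ->
  (1 - eps ^+ 2) * norm2 g ^+ 2 <= norm2 (truncate eps g) ^+ 2.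
Proof.
move=> eps0.
have -> : norm2 (truncate eps g) ^+ 2 =
    \sum_(x <- decr_abs g | cut_threshold eps g <= x) x ^+ 2.
  rewrite sqr_norm2 -(sum_decr_abs g (fun x => cut_threshold eps g <= x)).
  rewrite [RHS]big_mkcond/=; apply: eq_bigr => i _; rewrite mxE.
  by case: ifPn => // _; rewrite expr0n.
rewrite /cut_threshold -/(decr_abs g).
set P := fun k : nat => _; set k := find P (iota 0 p).
have [kp|pk] := ltnP k p; last first.
  (* No cut index exists: the threshold is the default value 0 of [nth], and every coordinate is
     kept. *)
  rewrite nth_default ?size_decr_abs//.
  rewrite -(sum_decr_abs g (fun x => 0 <= x)).
  under eq_bigl do rewrite normr_ge0.
  by rewrite -sqr_norm2 ler_piMl ?sqr_ge0// gerBl sqr_ge0.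
have : has P (iota 0 p) by rewrite has_find size_iota.
move=> /(nth_find 0%N); rewrite -/k nth_iota// add0n => /le_trans; apply.
rewrite [leRHS](big_nth 0) size_decr_abs.
rewrite [leRHS](@big_cat_nat _ _ _ k)//=; last exact: ltnW.
rewrite -[leLHS]addr0 lerD//; last first.
  by apply: sumr_ge0 => i _; exact: sqr_ge0.
rewrite le_eqVlt; apply/orP; left; apply/eqP.
rewrite big_nat_cond [RHS]big_nat_cond; apply: eq_bigl => i.
case: (ltnP i k) => //= ik; rewrite nth_decr_le ?sorted_decr_abs//.
- exact: ltnW.
- by rewrite size_decr_abs.
Qed.

Lemma norm2_truncate_le g eps : norm2 (truncate eps g) <= norm2 g.
Proof.
rewrite ler_wsqrtr// ler_sum// => i _; rewrite mxE.
by case: ifPn => // _; rewrite expr0n sqr_ge0.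
Qed.

(** Kept and removed coordinates have disjoint supports, so the removed mass is exactly |g|^2 -
    |truncate g|^2. *)
Lemma norm2_truncateB_le g eps : 0 <= eps ->
  norm2 (truncate eps g - g) <= eps * norm2 g.
Proof.
move=> eps0.
rewrite -(ler_pXn2r (n := 2))// ?nnegrE ?mulr_ge0 ?norm2_ge0// exprMn.
have -> : norm2 (truncate eps g - g) ^+ 2 =
    norm2 g ^+ 2 - norm2 (truncate eps g) ^+ 2.
  rewrite !sqr_norm2 -sumrB; apply: eq_bigr => i _; rewrite !mxE.
  by case: ifPn => _; ring.
have := truncated_mass_ge g eps0; lra.
Qed.

End truncation.

(** * Measurability of the iterates *)

Lemma measurable_countable_selection {d d' : measure_display}
    {T : measurableType d} {U : measurableType d'} (C : countType)
    (N : T -> C) (f : C -> T -> U) :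
  (forall c, measurable (N @^-1` [set c])) ->
  (forall c, measurable_fun [set: T] (f c)) ->
  measurable_fun [set: T] (fun x => f (N x) x).
Proof.
move=> mN mf _ Y mY; rewrite setTI.
rewrite [X in measurable X](_ : _ =
  \bigcup_c (N @^-1` [set c] `&` f c @^-1` Y)); last first.
  by apply/seteqP; split => [x fx|x [c _ [<-]]//]; exists (N x).
apply: countable_bigcupT_measurable => // c.
by apply: measurableI => //; rewrite -[X in measurable X]setTI; exact: mf.
Qed.

Lemma measurable_preimage_true {d : measure_display} {T : measurableType d}
    (b : T -> bool) :
  measurable_fun [set: T] b -> measurable [set x | b x].
Proof.
by move=> mb; have := mb measurableT [set true] I; rewrite setTI.
Qed.

Section caratheodory.
Context {R : realType} {p : nat}.

(* V is rounded to the grid of mesh 1/(k+1): the composition with the rounded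
   V is a countable gluing of measurable functions, and k tends to infinity. *)
Lemma lipschitz_measurable_comp {d d' : measure_display}
    {T : measurableType d} {Z : measurableType d'} (K : R)
    (F : 'rV[R]_p -> Z -> R) (V : T -> 'rV[R]_p) (X : T -> Z) :
  (forall w, measurable_fun [set: Z] (F w)) ->
  (forall z w w', `|F w z - F w' z| <= K * norm2 (w - w')) ->
  (forall i, measurable_fun [set: T] (fun x => V x 0 i)) ->
  measurable_fun [set: T] X ->
  measurable_fun [set: T] (fun x => F (V x) (X x)).
Proof.
move=> mF lF mV mX.
pose N (k : nat) (x : T) : {ffun 'I_p -> int} :=
  [ffun i => Num.floor (V x 0 i * k.+1%:R)].
pose D (k : nat) (m : {ffun 'I_p -> int}) : 'rV[R]_p :=
  \row_i ((m i)%:~R / k.+1%:R).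
have mN k c : measurable (N k @^-1` [set c]).
  rewrite [X in measurable X](_ : _ = [set x | [forall i,
      ((c i)%:~R <= V x 0 i * k.+1%:R) && (V x 0 i * k.+1%:R < (c i +
        1)%:~R)]]).
    apply: measurable_preimage_true.
    rewrite (_ : (fun x => _) = (fun x => \big[andb/true]_(i <- enum 'I_p)
      (((c i)%:~R <= V x 0 i * k.+1%:R) && (V x 0 i * k.+1%:R < (c i +
        1)%:~R)))).
      elim: (enum _) => [|i s IH].
        by under eq_fun do rewrite big_nil; exact: measurable_cst.
      under eq_fun do rewrite big_cons.
      apply: measurable_and => //; apply: measurable_and.
        by apply: measurable_fun_ler => //; exact: measurable_funM.
      by apply: measurable_fun_ltr => //; exact: measurable_funM.
    by apply/funext => x; rewrite big_enum/= big_andE.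
  apply/seteqP; split => x /=.
    by move=> <-; apply/forallP => i; rewrite ffunE floor_itv.
  move=> /forallP xc; apply/ffunP => i; rewrite ffunE; exact: floor_def.
have mD k : measurable_fun [set: T] (fun x => F (D k (N k x)) (X x)).
  apply: (measurable_countable_selection (N := N k)
    (f := fun c x => F (D k c) (X x))).
    by move=> c; exact: mN.
  by move=> c; exact: (measurableT_comp (mF _)).
apply: (measurable_fun_cvg mD) => x _.
have DV k i : `|D k (N k x) 0 i - V x 0 i| <= k.+1%:R^-1.
  rewrite mxE ffunE -[X in `|_ - X|](@mulfK _ k.+1%:R)// -mulrBl normrM.
  rewrite [X in _ * X]ger0_norm ?invr_ge0// ler_piMl ?invr_ge0//.
  have /andP[h1 h2] := floor_itv (V x 0 i * k.+1%:R).
  move: h2; rewrite intrD1 => h2; rewrite ler_norml; lra.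
apply/cvgrPdist_le => e e0.
pose a := e^-1 * (`|K| * p.+1%:R).
near=> k.
rewrite distrC (le_trans (lF _ _ _))//.
rewrite (@le_trans _ _ (`|K| * (p.+1%:R * k.+1%:R^-1)))//.
  rewrite (le_trans (ler_wpM2r (norm2_ge0 _) (ler_norm K)))// ler_wpM2l//.
  by apply: norm2_le_coord => // i; rewrite mxE [X in _ + X]mxE.
rewrite mulrA ler_pdivrMr// -ler_pdivrMl// -/a.
rewrite (@le_trans _ _ k%:R)//; last by rewrite ler_nat.
near: k; exact: nbhs_infty_ger.
Unshelve. all: by end_near. Qed.

(** A partial derivative is the limit of the difference quotients with increments 1/(k+1), each
    measurable in z. *)
Lemma grad_measurable {d : measure_display} {Z : measurableType d}
    (l : 'rV[R]_p -> Z -> R) (w : 'rV[R]_p) (i : 'I_p) :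
  (forall w, measurable_fun [set: Z] (l w)) ->
  (forall z w, differentiable (l^~ z) w) ->
  measurable_fun [set: Z] (fun z => grad (l^~ z) w 0 i).
Proof.
move=> ml dl.
pose h (k : nat) : R := k.+1%:R^-1.
pose D (k : nat) (z : Z) :=
  (h k)^-1 *: (l (h k *: (delta_mx 0 i : 'rV[R]_p) + w) z - l w z).
have mD k : measurable_fun [set: Z] (D k).
  apply: measurable_funM; first exact: measurable_cst.
  by apply: measurable_funB; exact: ml.
apply: (measurable_fun_cvg mD) => z _; rewrite mxE.
have dz : derivable (l^~ z) w (delta_mx 0 i : 'rV[R]_p) by exact:
  diff_derivable.
have h0 : h @ \oo --> (0 : R)^'.
  have h0 : h @ \oo --> (0 : R) by exact: cvg_harmonic.
  move=> A /= [e /= e0 eA]; change (\forall k \near \oo, A (h k)).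
  near=> k; apply: eA => /=; last by rewrite gt_eqF// invr_gt0.
  by near: k; move/cvgrPdist_lt : h0; exact.
exact: (cvg_comp _ _ h0 dz).
Unshelve. all: by end_near. Qed.

End caratheodory.

Section measurable_truncate.
Context {R : realType} {p : nat} {d : measure_display} {T : measurableType d}.
Variables (V : T -> 'rV[R]_p) (eps : R).
Hypothesis mV : forall i, measurable_fun [set: T] (fun x => V x 0 i).

Lemma decr_abs_measurable (k : nat) :
  measurable_fun [set: T] (fun x => (decr_abs (V x))`_k).
Proof.
have [kp|pk] := ltnP k p; last first.
  under eq_fun do rewrite nth_default ?size_decr_abs//.
  exact: measurable_cst.
apply: (measurability _ (RGenOInfty.measurableE R)) => //.
move=> _ [_ [a ->] <-]; rewrite setTI.
rewrite [X in measurable X](_ : _ = [set x | ~~ ((\sum_(i <- enum 'I_p)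
    (if a < `|V x 0 i| then 1 else 0)) <= k%:R :> R)]).
  apply: measurable_preimage_true; apply: measurable_neg.
  apply: measurable_fun_ler; last exact: measurable_cst.
  apply: measurable_sum => i; apply: measurable_fun_ifT => //.
  apply: measurable_fun_ltr => //; exact: measurableT_comp.
(* the k-th order statistic exceeds a iff more than k coordinates do *)
apply/seteqP; split => x /=; rewrite in_itv/= andbT ltNge;
  rewrite nth_decr_leE ?sorted_decr_abs ?size_decr_abs// count_sort count_map;
  rewrite -sum1_count -(ler_nat R) natr_sum -big_mkcond/=;
  by under [in X in _ -> X]eq_bigl do [].
Qed.

Lemma cut_threshold_measurable :
  measurable_fun [set: T] (fun x => cut_threshold eps (V x)).
Proof.
rewrite /cut_threshold.
pose P (k : nat) x : bool := (1 - eps ^+ 2) * norm2 (V x) ^+ 2 <=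
  \sum_(0 <= j < k) (decr_abs (V x))`_j ^+ 2.
have mP k : measurable_fun [set: T] (P k).
  rewrite /P; under eq_fun do rewrite sqr_norm2.
  apply: measurable_fun_ler.
    apply: measurable_funM; first exact: measurable_cst.
    by apply: measurable_sum => i; exact: measurable_funX.
  apply: measurable_sum => i; apply: measurable_funX.
  exact: decr_abs_measurable.
(* Over [iota m q], [find] is a chain of q nested tests; the starting point m must stay free for the
   induction on q. *)
suff H q m : measurable_fun [set: T]
    (fun x => (decr_abs (V x))`_(m + find (P^~ x) (iota m q))).
  have := H p 0%N; under eq_fun do rewrite add0n; exact.
elim: q m => [|q IH] m /=.
  exact: decr_abs_measurable.
rewrite (_ : (fun x => _) = (fun x => if P m x then (decr_abs (V x))`_m else
   (decr_abs (V x))`_(m.+1 + find (P^~ x) (iota m.+1 q)))).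
  apply: measurable_fun_ifT => //; exact: decr_abs_measurable.
by apply/funext => x; case: ifP => _; rewrite ?addn0// addnS addSn.
Qed.

Lemma truncate_measurable (i : 'I_p) :
  measurable_fun [set: T] (fun x => truncate eps (V x) 0 i).
Proof.
under eq_fun do rewrite mxE.
apply: measurable_fun_ifT => //.
apply: measurable_fun_ler; first exact: cut_threshold_measurable.
exact: measurableT_comp.
Qed.

End measurable_truncate.

(** * Paths of truncated SGD driven by a sequence of examples *)

Fixpoint sgd_path (R : realType) (p : nat) (Z : Type) (l : 'rV[R]_p -> Z -> R)
    (eps : R) (eta : nat -> R) (w0 : 'rV[R]_p) (x : nat -> Z) (t : nat)
    {struct t} : 'rV[R]_p :=
  if t is t'.+1 then
    let w := sgd_path l eps eta w0 x t' in
    w - eta t'.+1 *: truncate eps (grad (l^~ (x t')) w)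
  else w0.

Section paths.
Context {R : realType} {p : nat}.

Lemma eq_sgd_path (Z : Type) (l : 'rV[R]_p -> Z -> R) eps eta w0
    (x y : nat -> Z) t :
  (forall s, (s < t)%N -> x s = y s) ->
  sgd_path l eps eta w0 x t = sgd_path l eps eta w0 y t.
Proof.
elim: t => [//|t IH] xy.
have E := IH (fun s st => xy s (ltnW st)); have xyt := xy t (ltnSn t).
by rewrite /= E xyt.
Qed.

(** With batches of one example the run only sees the sequence of drawn examples; altering the data
    becomes altering that sequence. *)
Lemma tsgd_singletons (n : nat) (Z : Type) (l : 'rV[R]_p -> Z -> R) eps eta w0
    (S : 'I_n -> Z) (B : nat -> seq 'I_n) (b : nat -> 'I_n) t :
  (forall s, (s < t)%N -> B s = [:: b s]) ->
  tsgd l eps eta w0 S B t = sgd_path l eps eta w0 (fun s => S (b s)) t.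
Proof.
elim: t => //= t IH Bb; rewrite IH; last by move=> s st; rewrite Bb// ltnW.
by rewrite Bb// /batch_grad/= big_seq1 invr1 scale1r.
Qed.

Context {d : measure_display} {Z : measurableType d}.
Variables (l : 'rV[R]_p -> Z -> R) (G L lstar : R).
Hypothesis lA : loss_assumptions l G L lstar.

(** Truncation is discontinuous but measurable, and the gradient, measurable in z and Lipschitz in
    w, can be composed with the previous iterate. *)
Lemma sgd_path_measurable {d' : measure_display} {T : measurableType d'}
    eps eta w0 (X : nat -> T -> Z) t :
  (forall s, measurable_fun [set: T] (X s)) ->
  forall i, measurable_fun [set: T]
    (fun x => sgd_path l eps eta w0 (X^~ x) t 0 i).
Proof.
move=> mX; elim: t => [|t IH] i /=; first exact: measurable_cst.
rewrite (_ : (fun x => _) = (fun x => sgd_path l eps eta w0 (X^~ x) t 0 i -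
   eta t.+1 * truncate eps
     (grad (l^~ (X t x)) (sgd_path l eps eta w0 (X^~ x) t)) 0 i)); last first.
  by apply/funext => x; rewrite mxE [X in _ + X]mxE [X in _ - X]mxE.
apply: measurable_funB => //; apply: measurable_funM => //.
apply: truncate_measurable => j.
case: lA => ml dl _ _ lL.
apply: (lipschitz_measurable_comp (K := L)
  (F := fun w z => grad (l^~ z) w 0 j) (X := X t)
  (V := fun x => sgd_path l eps eta w0 (X^~ x) t) _ _ IH (mX t)) => //.
- by move=> w; exact: (grad_measurable _ _ ml dl).
- move=> z w w'; rewrite (le_trans _ (lL z w w'))//.
  by have := coord_le_norm2 (grad (l^~ z) w - grad (l^~ z) w') j; rewrite !mxE.
Qed.

Lemma loss_lipschitz z w w' : `|l w z - l w' z| <= G * norm2 (w - w').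
Proof. by case: lA => _ dl lG _ _; exact: (bounded_grad_lipschitz (f := l^~
  z)). Qed.

Lemma sgd_path_dist_w0 eps eta w0 x t :
  (forall s, (1 <= s <= t)%N -> 0 <= eta s) ->
  norm2 (sgd_path l eps eta w0 x t - w0) <= G * \sum_(1 <= s < t.+1) eta s.
Proof.
case: lA => _ _ lG _ _.
elim: t => [|t IH] eta0 /=.
  by rewrite big_nil mulr0 subrr norm2_0.
rewrite big_nat_recr//= mulrDr addrAC (le_trans (norm2B _ _))// lerD//.
  by apply: IH => s /andP[s1 st]; rewrite eta0// s1 ltnW.
rewrite norm2Z mulrC ger0_norm ?eta0//= ler_wpM2r ?eta0//=.
exact: le_trans (norm2_truncate_le _ _) (lG _ _).
Qed.

Lemma step_dist_le (e : R) (w w' a a' : 'rV[R]_p) : 0 <= e ->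
  norm2 ((w - e *: a) - (w' - e *: a')) <= norm2 (w - w') + e * norm2 (a - a').
Proof.
move=> e0.
have -> : (w - e *: a) - (w' - e *: a') = (w - w') - e *: (a - a').
  by apply/rowP => i; rewrite !mxE; ring.
by rewrite (le_trans (norm2B _ _))// norm2Z ger0_norm.
Qed.

Lemma sgd_step_dist_le eps (e : R) z z' w w' : 0 <= e ->
  norm2 ((w - e *: truncate eps (grad (l^~ z) w))
         - (w' - e *: truncate eps (grad (l^~ z') w'))) <=
  norm2 (w - w') + e * (2 * G).
Proof.
case: lA => _ _ lG _ _ e0.
rewrite (le_trans (step_dist_le _ _ _ _ e0))// lerD2l ler_wpM2l//.
rewrite (le_trans (norm2B _ _))// mulrDl mul1r.
by rewrite lerD// (le_trans (norm2_truncate_le _ _)).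
Qed.

(** Truncation is not Lipschitz, so the untruncated gradients are compared by smoothness and each of
    the two truncation residuals is bounded by G eps. *)
Lemma sgd_step_same_dist_le eps (e : R) z w w' : 0 <= e -> 0 <= eps ->
  norm2 ((w - e *: truncate eps (grad (l^~ z) w))
         - (w' - e *: truncate eps (grad (l^~ z) w'))) <=
  norm2 (w - w') + e * (L * norm2 (w - w') + 2 * G * eps).
Proof.
case: lA => _ _ lG _ lL e0 eps0.
rewrite (le_trans (step_dist_le _ _ _ _ e0))// lerD2l ler_wpM2l//.
set g := grad _ w; set g' := grad _ w'.
have -> : truncate eps g - truncate eps g' =
    (g - g') + ((truncate eps g - g) - (truncate eps g' - g')).
  by apply/rowP => i; rewrite !mxE; ring.
rewrite (le_trans (norm2D _ _))// lerD ?lL// (le_trans (norm2B _ _))//.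
rewrite -mulrA mulrDl mul1r lerD// (le_trans (norm2_truncateB_le _ eps0))//;
  by rewrite mulrC ler_wpM2r// lG.
Qed.

End paths.

(** * Independence of the examples and the draws *)

Section bounded.
Context {R : realType} {d : measure_display} {T : measurableType d}.
Context {Pr : probability T R}.

Lemma bounded_integrable (f : T -> R) (M : R) :
  measurable_fun [set: T] f -> (forall x, `|f x| <= M) ->
  Pr.-integrable [set: T] (EFin \o f).
Proof.
move=> mf fM; apply: measurable_bounded_integrable => //.
  by rewrite -ge0_fin_numE// fin_num_measure.
exists M; split; first exact: num_real.
by move=> r Mr x _; exact: le_trans (fM x) (ltW Mr).
Qed.

Lemma Rintegral_cst_probability (r : R) : \int[Pr]_x (cst r x) = r.
Proof.
by rewrite Rintegral_cst// [X in _ * X](congr1 fine (probability_setT Pr))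
  mulr1.
Qed.

Lemma Rintegral_le_cst (f : T -> R) (M : R) :
  Pr.-integrable [set: T] (EFin \o f) -> (forall x, f x <= M) ->
  \int[Pr]_x f x <= M.
Proof.
move=> fi fM; rewrite -[leRHS](Rintegral_cst_probability M).
apply: le_Rintegral => //.
exact: (bounded_integrable (M := `|M|)).
Qed.

Lemma Rintegral_norm_le (f : T -> R) (M : R) :
  measurable_fun [set: T] f -> (forall x, `|f x| <= M) ->
  `|\int[Pr]_x f x| <= M.
Proof.
move=> mf fM; have fi := bounded_integrable mf fM.
rewrite (le_trans (le_normr_Rintegral _ _))//.
apply: Rintegral_le_cst => //.
apply: (@bounded_integrable _ M); first exact: measurableT_comp.
by move=> x; rewrite normr_id.
Qed.

End bounded.

Section independence.
Context {R : realType} {d d' : measure_display} {Omega : measurableType d}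
  {Z : measurableType d'}.
Variables (P : probability Z R) (Pr : probability Omega R) (X : {RV Pr >-> Z}).
Variable G : set (set Omega).
Hypothesis Gm : G `<=` measurable.
Hypothesis GI : setI_closed G.
Hypothesis GT : G [set: Omega].
Hypothesis indG : forall E A, G E -> measurable A ->
  Pr (E `&` X @^-1` A) = (Pr E * P A)%E.

Lemma sub_sigma_measurable : <<s G >> `<=` measurable.
Proof.
exact: (smallest_sub (@sigma_algebra_measurable _ Omega) Gm).
Qed.

(** For fixed [A], both sides are finite measures in [E] that agree on the pi-system [G], hence on
    the sigma-algebra it generates. *)
Lemma independent_g_sigma (E : set Omega) (A : set Z) :
  <<s G >> E -> measurable A -> Pr (E `&` X @^-1` A) = (Pr E * P A)%E.
Proof.
move=> GE mA.
have mXA : measurable (X @^-1` A) by exact: measurable_funPTI.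
have PA : P A = (fine (P A))%:E by rewrite fineK// fin_num_measure.
pose r : {nonneg R} := NngNum (fine_ge0 (measure_ge0 P A)).
have := @g_sigma_algebra_measure_unique _ _ _ G Gm (fun=> setT) (fun=> GT) _
  (mrestr Pr mXA) (mscale r Pr) GI _ _ E GE.
rewrite /= /mrestr /mscale/= -PA muleC; apply.
- by rewrite bigcup_const.
- by move=> B GB; rewrite indG// muleC.
- by move=> _; rewrite setTI (le_lt_trans (probability_le1 _ _))// ltry.
Qed.

(** [Omega] with the smaller sigma-algebra: measurability on [H] is how independence from [X] is
    expressed for functions. *)
Let H := g_sigma_algebraType G.

Lemma measurable_to_sub : measurable_fun [set: Omega] (id : Omega -> H).
Proof. by move=> _ Y mY; rewrite setTI; exact: sub_sigma_measurable. Qed.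

Let toH : {mfun Omega >-> H} := mfun_Sub (mem_set measurable_to_sub).

(** By independence the law of w |-> (w, X w) on [H * Z] is a product measure, so X w may be
    integrated out first with w frozen. *)
Lemma independent_Fubini (F : H * Z -> R) (M : R) (f : Omega -> R) (M' : R) :
  measurable_fun [set: H * Z] F -> (forall x, `|F x| <= M) ->
  measurable_fun [set: Omega] f -> (forall x, `|f x| <= M') ->
  (forall w, \int[P]_z F (w, z) <= f w) ->
  \int[Pr]_w F (w, X w) <= \int[Pr]_w f w.
Proof.
move=> mF FM mf fM Ff.
pose Q : probability H R := distribution Pr toH.
have mpair : measurable_fun [set: Omega] (fun w => (w : H, X w)).
  by apply: measurable_fun_pair => //; exact: measurable_to_sub.
have prodE A : measurable A ->
    (Q \x P)%E A = pushforward Pr (fun w => (w : H, X w)) A.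
  apply: product_measure_unique => B C mB mC.
  rewrite /pushforward/= -(independent_g_sigma mB mC); congr (Pr _).
have Fi : (Q \x P)%E.-integrable [set: H * Z] (EFin \o F).
  apply: measurable_bounded_integrable => //.
    rewrite [X in (X < _)%E](prodE _ measurableT) /pushforward preimage_setT.
    by rewrite -ge0_fin_numE// fin_num_measure.
  exists M; split; first exact: num_real.
  by move=> r Mr x _; exact: le_trans (FM x) (ltW Mr).
have FXi : Pr.-integrable [set: Omega] (EFin \o (fun w => F (w, X w))).
  apply: (bounded_integrable (M := M)) => //.
  exact: (measurableT_comp mF mpair).
have -> : \int[Pr]_w F (w, X w) = fine (\int[Q \x P]_x (F x)%:E)%E.
  rewrite (eq_measure_integral (pushforward Pr (fun w => (w : H, X w)))).
    rewrite integral_pushforward//; exact/measurable_EFinP.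
  by move=> A mA _; exact: prodE.
rewrite -integral12_prod_meas1// /fubini_F/=.
pose F1 w := \int[P]_z F (w, z).
have mFw w : measurable_fun [set: Z] (fun z => F (w, z)).
  exact: measurableT_comp.
have F1E w : (\int[P]_z (F (w, z))%:E)%E = (F1 w)%:E.
  rewrite fineK// integrable_fin_num//.
  exact: (bounded_integrable (M := M)).
have mF1 : measurable_fun [set: H] F1.
  apply/measurable_EFinP; apply: eq_measurable_fun (measurable_fubini_F Fi).
  by move=> w _; rewrite /fubini_F/= F1E.
have F1M w : `|F1 w| <= M by apply: Rintegral_norm_le.
have mF1' : measurable_fun [set: Omega] F1.
  exact: (measurableT_comp mF1 measurable_to_sub).
have F1i : Pr.-integrable [set: Omega] (EFin \o F1).
  exact: (bounded_integrable (M := M)).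
under eq_integral do rewrite F1E.
rewrite (integral_pushforward (f := EFin \o F1) measurable_to_sub)//.
  rewrite preimage_setT; apply: le_Rintegral => //.
  - exact: bounded_integrable mf fM.
  - by move=> w _; exact: Ff.
exact/measurable_EFinP.
Qed.
End independence.

Section sampling.
Context {R : realType} {n T : nat} {d d' : measure_display}
  {Z : measurableType d} {Omega : measurableType d'}.
Variables (P : probability Z R) (Pr : probability Omega R).
Variables (S : 'I_n -> {RV Pr >-> Z}) (B : nat -> Omega -> 1.-tuple 'I_n).
Hypothesis smp : tsgd_sampling T P S B.

Let events := @sampling_events n 1 T d d' Z Omega S B.

Lemma eventsT k : events k [set: Omega].
Proof. by case: k => [j|t] /=; exists setT. Qed.

Lemma eventsI k : setI_closed (events k).
Proof.
case: k => [j|t] _ _ [A mA <-] [A' mA' <-] /=; exists (A `&` A') => //.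
exact: measurableI.
Qed.

Lemma events_measurable k : events k `<=` measurable.
Proof. by case: smp => _ _ [+ _]; exact. Qed.

Lemma events_independent (E : 'I_n + 'I_T -> set Omega) :
  (forall k, events k (E k)) -> Pr (\bigcap_k E k) = (\prod_k Pr (E k))%E.
Proof.
move=> Ek; case: smp => _ _ [_ /(_ [set: 'I_n + 'I_T]%SET E)] h.
have IT : [set` [set: 'I_n + 'I_T]%SET] = [set: 'I_n + 'I_T].
  by apply/seteqP; split => k //= _; rewrite finset.in_setT.
rewrite -[X in bigcap X _]IT.
rewrite h//; last by move=> k _; exact: Ek.
by apply: eq_bigl => k; rewrite finset.in_setT.
Qed.

(* A pi-system generating the sigma-algebra of the batches and of all the
   examples except S j; it is independent of S j. *)
Definition events_but (j : 'I_n) : set (set Omega) :=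
  [set E | exists F : 'I_n + 'I_T -> set Omega,
    [/\ forall k, events k (F k), F (inl j) = setT & E = \bigcap_k F k]].

Lemma events_but_measurable j : events_but j `<=` measurable.
Proof.
move=> _ [F [FE _ ->]]; apply: fin_bigcap_measurable => // k _.
exact: (events_measurable (FE k)).
Qed.

Lemma events_butI j : setI_closed (events_but j).
Proof.
move=> _ _ [F [FE Fj ->]] [F' [FE' Fj' ->]].
exists (fun k => F k `&` F' k); split.
- by move=> k; exact: eventsI.
- by rewrite Fj Fj' setIT.
- by rewrite bigcapI.
Qed.

Lemma events_butT j : events_but j [set: Omega].
Proof.
by exists (fun=> setT); split => [k|//|]; [exact: eventsT|rewrite bigcapT].
Qed.

(** A member of [events_but j] leaves slot j free; putting the event of S j there gives an
    intersection to which mutual independence applies. *)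
Lemma events_but_independent j E A : events_but j E -> measurable A ->
  Pr (E `&` S j @^-1` A) = (Pr E * P A)%E.
Proof.
move=> [F [FE Fj ->]] mA.
pose F' k := if k == inl j then S j @^-1` A else F k.
have F'E k : events k (F' k).
  by rewrite /F'; case: eqP => [->|_]; [exists A|exact: FE].
have -> : \bigcap_k F k `&` S j @^-1` A = \bigcap_k F' k.
  apply/seteqP; split => w /=.
    by move=> [Fw Sw] k _; rewrite /F'; case: eqP => // _; exact: Fw.
  move=> F'w; split; last by have := F'w (inl j) I; rewrite /F' eqxx.
  move=> k _; have := F'w k I; rewrite /F'.
  by case: eqP => [->|//]; rewrite Fj.
rewrite !events_independent//.
rewrite (bigD1 (inl j))//= [in RHS](bigD1 (inl j))//= Fj.
rewrite [X in _ = (X * _ * _)%E](probability_setT Pr) mul1e muleC; congr (_ *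
  _)%E.
  apply: eq_bigr => k kj; by rewrite /F' (negbTE kj).
by rewrite /F' eqxx; case: smp => + _ _; exact.
Qed.

Lemma example_measurable_but j k : k != j ->
  measurable_fun [set: g_sigma_algebraType (events_but j)] (S k).
Proof.
move=> kj _ A mA; rewrite setTI; apply: sub_sigma_algebra.
exists (fun i => if i == inl k then S k @^-1` A else setT); split.
- by move=> i; case: eqP => [->|_]; [exists A|exact: eventsT].
- by rewrite (inj_eq (@inl_inj _ _)) eq_sym (negbTE kj).
- apply/seteqP; split => w /=.
    by move=> Aw i _; case: eqP.
  by move=> /(_ (inl k) I); rewrite eqxx.
Qed.

Definition draws (b : {ffun 'I_T -> 'I_n}) : set Omega :=
  [set w | forall t : 'I_T, B t w = [tuple b t]].

Let draw_event (b : {ffun 'I_T -> 'I_n}) (k : 'I_n + 'I_T) : set Omega :=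
  if k is inr t then B t @^-1` [set [tuple b t]] else setT.

Lemma draw_events b k : events k (draw_event b k).
Proof. by case: k => [j|t]; [exact: eventsT|exists [set [tuple b t]]]. Qed.

Lemma drawsE b : draws b = \bigcap_k draw_event b k.
Proof.
apply/seteqP; split => w /=; first by move=> Bb [j|t] _ //=; exact: Bb.
by move=> Bb t; exact: (Bb (inr t) I).
Qed.

(** The event constrains the batches only, so its indicator may be kept while S j is integrated
    out. *)
Lemma draws_but b j : events_but j (draws b).
Proof.
exists (draw_event b); split => //; first exact: draw_events.
exact: drawsE.
Qed.

Lemma draws_measurable b : measurable (draws b).
Proof.
rewrite drawsE; apply: fin_bigcap_measurable => // k _.
exact: (events_measurable (draw_events b k)).
Qed.

Lemma probability_draws b : Pr (draws b) = ((n%:R ^+ T)^-1)%:E.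
Proof.
rewrite drawsE events_independent; last exact: draw_events.
rewrite big_sumType/= big1 ?mul1e; last by move=> j _; exact: probability_setT.
rewrite (eq_bigr (fun=> (n%:R^-1)%:E)).
  by rewrite prodEFin prodr_const card_ord exprVn.
by move=> t _; case: smp => _ -> _; rewrite card_tuple card_ord expn1.
Qed.

Lemma draws_partition w : exists2 b, draws b w & forall b', b' != b -> ~ draws
  b' w.
Proof.
exists [ffun t : 'I_T => thead (B t w)].
  by move=> t; rewrite ffunE; case/tupleP: (B t w) => x s; rewrite (tuple0 s)
    theadE.
move=> b' + bw; apply/negP; rewrite negbK; apply/eqP/ffunP => t.
by rewrite ffunE bw theadE.
Qed.

End sampling.

(** * Exponential and polynomial moments for fixed draws *)

Section expR_bounds.
Context {R : realType}.

(** exp y <= 1/(1 - y), and (1 - y)(1 + y + 2 y^2) = 1 + y^2 (1 - 2 y) >= 1. The linear term has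
    coefficient 1, so that it integrates to 0 for a centered variable. *)
Lemma expR_le_quadratic (y : R) : y <= 2^-1 -> expR y <= 1 + y + 2 * y ^+ 2.
Proof.
move=> y2; have y1 : 0 < 1 - y by lra.
rewrite -[expR y]invrK -expRN -[leRHS]invrK lef_pV2 ?posrE ?invr_gt0
  ?expR_gt0//.
  rewrite (@le_trans _ _ (1 - y))//; last first.
    by have := expR_ge1Dx (- y); lra.
  rewrite -[leLHS]mul1r ler_pdivrMr; nra.
nra.
Qed.

(** |x|^q / q! is a term of the series of exp |x|, which is one of the two exponentials; evenness
    removes the sign. *)
Lemma exprn_le_expR (q : nat) (x : R) : ~~ odd q ->
  x ^+ q <= q`!%:R * (expR x + expR (- x)).
Proof.
move=> q_even.
have f0 : 0 < q`!%:R :> R by rewrite ltr0n fact_gt0.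
have H (y : R) : 0 <= y -> y ^+ q <= q`!%:R * expR y.
  case: q f0 {q_even} => [|q] f0 y0; first by
    rewrite fact0 mul1r expr0 (le_trans _ (expR_ge1Dx y))// lerDl.
  rewrite mulrC -ler_pdivrMr// (le_trans _ (expR_ge1Dxn q y0))// lerDr.
  exact: ler01.
have [x0|x0] := leP 0 x.
  by rewrite (le_trans (H x x0))// ler_wpM2l ?ler0n// lerDl expR_ge0.
have -> : x ^+ q = (- x) ^+ q.
  by rewrite exprNn -signr_odd (negbTE q_even) expr0 mul1r.
rewrite (le_trans (H (- x) _))//; first lra.
by rewrite ler_wpM2l ?ler0n// lerDr expR_ge0.
Qed.

End expR_bounds.

Section fixed_draws.
Context {R : realType} {n T : nat} {d d' : measure_display}
  {Z : measurableType d} {Omega : measurableType d'}.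
Variables (P : probability Z R) (Pr : probability Omega R).
Variables (S : 'I_n -> {RV Pr >-> Z}) (B : nat -> Omega -> 1.-tuple 'I_n).
Hypothesis smp : tsgd_sampling T P S B.
Variable b : {ffun 'I_T -> 'I_n}.
Let Db : set Omega := draws B b.
Let prb : R := (n%:R ^+ T)^-1.

Let mDb : measurable_fun [set: Omega] (\1_Db : Omega -> R).
Proof. by apply: measurable_indic; exact: (draws_measurable smp). Qed.

Lemma Rintegral_draws : \int[Pr]_w \1_Db w = prb.
Proof.
rewrite /Rintegral integral_indic//; last exact: (draws_measurable smp).
by rewrite setIT [X in fine X](probability_draws smp b).
Qed.

Lemma indic_norm_le (w : Omega) (x M : R) : `|x| <= M -> `|\1_Db w * x| <= M.
Proof.
move=> xM; rewrite normrM (le_trans _ xM)// ler_piMl//.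
by rewrite indicE; case: (_ \in _); rewrite ?normr1 ?normr0.
Qed.

Lemma draws_Fubini (j : 'I_n)
    (F : g_sigma_algebraType (events_but (T := T) S B j) * Z -> R) (M : R)
    (f : Omega -> R) (M' : R) :
  measurable_fun setT F -> (forall x, `|F x| <= M) ->
  measurable_fun [set: Omega] f -> (forall x, `|f x| <= M') ->
  (forall w, \int[P]_z F (w, z) <= f w) ->
  \int[Pr]_w F (w, S j w) <= \int[Pr]_w f w.
Proof.
apply: independent_Fubini.
- exact: (events_but_measurable smp).
- exact: events_butI.
- exact: events_butT.
- exact: (events_but_independent smp).
Qed.

Lemma draws_indic_measurable_but (j : 'I_n) :
  measurable_fun [set: g_sigma_algebraType (events_but (T := T) S B j)]
    (\1_Db : Omega -> R).
Proof.
apply: (@measurable_indic _ (g_sigma_algebraType (events_but (T := T) S B j))).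
by apply: sub_sigma_algebra; exact: draws_but.
Qed.

(** The examples are integrated out one at a time: as [s] has no repetition, the other factors and
    the indicator do not involve S j, and the mean of exp phi is at most 1 + 2 beta^2. *)
Lemma draws_exp_moment (phi : Z -> R) (beta : R) (s : seq 'I_n) :
  measurable_fun [set: Z] phi -> (forall z, `|phi z| <= beta) ->
  \int[P]_z phi z = 0 -> beta <= 2^-1 -> uniq s ->
  \int[Pr]_w (\1_Db w * \prod_(i <- s) expR (phi (S i w))) <=
  prb * (1 + 2 * beta ^+ 2) ^+ size s.
Proof.
move=> mphi phib phi0 beta2.
have iphi : P.-integrable [set: Z] (EFin \o phi).
  exact: bounded_integrable mphi phib.
have phile z : phi z <= beta by rewrite (le_trans (ler_norm _)).
have mexp : measurable_fun [set: Z] (fun z => expR (phi z)).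
  exact: measurableT_comp.
have bexp z : `|expR (phi z)| <= expR beta.
  by rewrite ger0_norm ?expR_ge0// ler_expR.
have iexp : P.-integrable [set: Z] (EFin \o (fun z => expR (phi z))).
  exact: bounded_integrable mexp bexp.
have Eexp : \int[P]_z expR (phi z) <= 1 + 2 * beta ^+ 2.
  have ic : P.-integrable [set: Z] (EFin \o cst (1 + 2 * beta ^+ 2)).
    apply: (bounded_integrable (M := `|1 + 2 * beta ^+ 2|)) => //.
  rewrite -[leRHS]addr0 -phi0 -[X in X + _](Rintegral_cst_probability (Pr :=
    P)).
  rewrite -RintegralD//; apply: le_Rintegral => //.
    exact: (integrableD _ ic iphi).
  move=> z _; rewrite (le_trans (expR_le_quadratic (le_trans (phile z)
    beta2)))//.
  rewrite addrAC lerD2r lerD2l ler_wpM2l// -[leLHS]real_normK ?num_real//.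
  by rewrite ler_pXn2r ?nnegrE// (le_trans _ (phib z)).
have bprod s' w : `|\prod_(i <- s') expR (phi (S i w))| <= expR beta ^+ size s'.
  elim: s' => [|i s' IH]; first by rewrite big_nil normr1.
  by rewrite big_cons normrM exprS ler_pM.
elim: s => [_|j s IH].
  under eq_Rintegral do rewrite big_nil mulr1.
  by rewrite Rintegral_draws mulr1.
move=> /= /andP[js us].
pose f w := \1_Db w * \prod_(i <- s) expR (phi (S i w)).
pose F (x : g_sigma_algebraType (events_but (T := T) S B j) * Z) :=
  f x.1 * expR (phi x.2).
rewrite (@eq_Rintegral _ _ _ _ _ (fun w => F (w, S j w))); last first.
  by move=> w _; rewrite /F/f/= big_cons mulrCA mulrC.
have mX k : k \in s ->
    measurable_fun [set: g_sigma_algebraType (events_but (T := T) S B j)]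
      (fun w => expR (phi (S k w))).
  move=> ks; apply: (measurableT_comp mexp).
  by apply: example_measurable_but; apply: contraNneq js => <-.
have mf : measurable_fun
    [set: g_sigma_algebraType (events_but (T := T) S B j)] f.
  apply: measurable_funM; first exact: draws_indic_measurable_but.
  exact: measurable_prod.
have fM w : `|f w| <= expR beta ^+ size s by exact: indic_norm_le.
have f0 w : 0 <= f w.
  by rewrite /f mulr_ge0 ?prodr_ge0// => i _; exact: expR_ge0.
have mf' : measurable_fun [set: Omega] f.
  apply: (measurableT_comp mf).
  exact: (measurable_to_sub (events_but_measurable smp (j := j))).
have mg : measurable_fun [set: Omega] (fun w => f w * (1 + 2 * beta ^+ 2)).
  exact: measurable_funM.
rewrite (@le_trans _ _ (\int[Pr]_w (f w * (1 + 2 * beta ^+ 2))))//.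
  apply: (@draws_Fubini j F (expR beta ^+ size s * expR beta) _
    (expR beta ^+ size s * `|1 + 2 * beta ^+ 2|)) => //.
  - apply: measurable_funM; first exact: (measurableT_comp mf).
    exact: (measurableT_comp mexp).
  - by move=> x; rewrite /F normrM ler_pM.
  - by move=> w; rewrite normrM ler_wpM2r.
  - by move=> w; rewrite /F/= RintegralZl// ler_wpM2l.
rewrite RintegralZr//; last exact: bounded_integrable mf' fM.
rewrite [_ ^+ (size s).+1]exprSr mulrA ler_wpM2r ?IH//.
by rewrite addr_ge0// mulr_ge0// sqr_ge0.
Qed.

End fixed_draws.

Section fixed_draws_moment.
Context {R : realType} {n T : nat} {d d' : measure_display}
  {Z : measurableType d} {Omega : measurableType d'}.
Variables (P : probability Z R) (Pr : probability Omega R).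
Variables (S : 'I_n -> {RV Pr >-> Z}) (B : nat -> Omega -> 1.-tuple 'I_n).
Hypothesis smp : tsgd_sampling T P S B.
Variable b : {ffun 'I_T -> 'I_n}.
Let Db : set Omega := draws B b.
Let prb : R := (n%:R ^+ T)^-1.

Let mDb : measurable_fun [set: Omega] (\1_Db : Omega -> R).
Proof. by apply: measurable_indic; exact: (draws_measurable smp). Qed.

(** At this scale 2 beta^2 = 1/(2T), so at most T factors 1 + 2 beta^2 multiply to at most e. *)
Lemma draws_exp_moment_unit (psi : Z -> R) (s : seq 'I_n) :
  (0 < T)%N -> uniq s -> (size s <= T)%N ->
  measurable_fun [set: Z] psi ->
  (forall z, `|psi z| <= (2 * Num.sqrt T%:R)^-1) -> \int[P]_z psi z = 0 ->
  \int[Pr]_w (\1_Db w * expR (\sum_(i <- s) psi (S i w))) <= prb * expR 1.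
Proof.
move=> T0 us sT mpsi bpsi psi0.
have T1 : 1 <= T%:R :> R by rewrite ler1n.
have sT1 : 1 <= Num.sqrt T%:R :> R by rewrite -[leLHS]sqrtr1 ler_wsqrtr.
under eq_Rintegral do rewrite expR_sum.
have b2 : (2 * Num.sqrt T%:R)^-1 <= 2^-1 :> R.
  by rewrite lef_pV2 ?posrE; lra.
rewrite (le_trans (draws_exp_moment smp b mpsi bpsi psi0 b2 us))//.
rewrite ler_wpM2l ?invr_ge0 ?exprn_ge0//.
rewrite (@le_trans _ _ (expR (T%:R^-1) ^+ T))//; last first.
  by rewrite -expRM_natr mulVf// pnatr_eq0 -lt0n.
have b1 : 1 + 2 * (2 * Num.sqrt T%:R)^-1 ^+ 2 <= expR (T%:R^-1) :> R.
  rewrite (le_trans _ (expR_ge1Dx _))// lerD2l exprVn exprMn sqr_sqrtr ?ler0n//.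
  rewrite invfM mulrA ler_piMl ?invr_ge0 ?ler0n//; lra.
rewrite (@le_trans _ _ (expR (T%:R^-1) ^+ size s))//.
  rewrite lerXn2r ?nnegrE ?expR_ge0// addr_ge0// mulr_ge0// sqr_ge0.
by rewrite ler_weXn2l// -[leLHS]expR0 ler_expR invr_ge0 ler0n.
Qed.

(** At most T independent centered terms of size beta fluctuate at scale beta sqrt T. The
    exponential bound is applied to phi / a and - phi / a, with a = 2 beta sqrt T, and turned into a
    power by [exprn_le_expR]. *)
Lemma draws_moment (phi : Z -> R) (beta : R) (s : seq 'I_n) (q : nat) :
  (0 < T)%N -> uniq s -> (size s <= T)%N -> ~~ odd q -> 0 < beta ->
  measurable_fun [set: Z] phi ->
  (forall z, `|phi z| <= beta) -> \int[P]_z phi z = 0 ->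
  \int[Pr]_w (\1_Db w * (\sum_(i <- s) phi (S i w)) ^+ q) <=
  prb * (2 * expR 1 * q`!%:R * (2 * Num.sqrt T%:R * beta) ^+ q).
Proof.
move=> T0 us sT qe beta0 mphi bphi phi0.
have sT0 : 0 < Num.sqrt T%:R :> R by rewrite sqrtr_gt0 ltr0n.
have iphi : P.-integrable [set: Z] (EFin \o phi).
  exact: bounded_integrable mphi bphi.
set a := 2 * Num.sqrt T%:R * beta.
have a0 : 0 < a by rewrite !mulr_gt0.
have msum (f : Z -> R) : measurable_fun [set: Z] f ->
    measurable_fun [set: Omega] (fun w => \sum_(i <- s) f (S i w)).
  by move=> mf; apply: measurable_sum => i; exact: measurableT_comp.
have bsum (f : Z -> R) (M : R) : (forall z, `|f z| <= M) ->
    forall w, `|\sum_(i <- s) f (S i w)| <= \sum_(i <- s) M.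
  move=> fM w; rewrite (le_trans (ler_norm_sum _ _ _))//.
  by apply: ler_sum => i _.
have mscaled (e : R) : measurable_fun [set: Z] (fun z => e * phi z).
  exact: measurable_funM.
have E (e : R) : `|e| = a^-1 ->
    \int[Pr]_w (\1_Db w * expR (\sum_(i <- s) (e * phi (S i w)))) <= prb * expR
      1.
  move=> ea; apply: (@draws_exp_moment_unit (fun z => e * phi z)) => //.
    move=> z; rewrite normrM ea /a invfM -[leRHS]mulr1 -mulrA ler_wpM2l//.
    by rewrite mulrC ler_pdivrMr// mul1r.
  by rewrite RintegralZl// phi0 mulr0.
have iE (e : R) : Pr.-integrable [set: Omega] (EFin \o
    (fun w => \1_Db w * expR (\sum_(i <- s) (e * phi (S i w))))).
  apply: (bounded_integrable (M := expR (\sum_(i <- s) `|e| * beta))).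
    apply: measurable_funM => //; apply: measurableT_comp => //.
    exact: (msum (fun z => e * phi z)).
  move=> w; apply: indic_norm_le; rewrite ger0_norm ?expR_ge0// ler_expR.
  rewrite (le_trans (ler_norm _))//.
  apply: (bsum (fun z => e * phi z)) => z.
  by rewrite normrM ler_wpM2l.
have aV : `|a^-1| = a^-1 by rewrite gtr0_norm ?invr_gt0.
have Ep := E _ aV.
have Em := E (- a^-1) (etrans (normrN _) aV).
pose C := q`!%:R * a ^+ q.
have C0 : 0 <= C by rewrite mulr_ge0 ?ler0n// exprn_ge0// ltW.
rewrite (@le_trans _ _ (\int[Pr]_w (C * (
   \1_Db w * expR (\sum_(i <- s) (a^-1 * phi (S i w))) +
   \1_Db w * expR (\sum_(i <- s) (- a^-1 * phi (S i w)))))))//.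
  apply: le_Rintegral => //.
  - apply: (bounded_integrable (M := (\sum_(i <- s) beta) ^+ q)).
      by apply: measurable_funM => //; apply: measurable_funX; exact: msum.
    move=> w; apply: indic_norm_le; rewrite normrX lerXn2r ?nnegrE//.
      by apply: sumr_ge0 => i _; exact: ltW.
    exact: bsum.
  - have := integrableZl measurableT C (integrableD measurableT (iE a^-1) (iE
    (- a^-1))).
    by [].
  - move=> w _; rewrite -mulrDr mulrCA ler_wpM2l//.
    have := exprn_le_expR (a^-1 * \sum_(i <- s) phi (S i w)) qe.
    rewrite exprMn exprVn -ler_pdivlMl ?exprn_gt0// ?invr_gt0 ?exprn_gt0//.
    rewrite invrK mulrA [_ * q`!%:R]mulrC -/C -mulNr !mulr_sumr; exact.
rewrite RintegralZl//; last exact: (integrableD measurableT (iE a^-1) (iE (-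
  a^-1))).
rewrite RintegralD// (le_trans (ler_wpM2l C0 (lerD Ep Em)))//.
rewrite /C; lra.
Qed.

End fixed_draws_moment.

(** * Leave-one-out comparison for fixed draws *)

Section leave_one_out.
Context {R : realType} {p n T' : nat} {d d' : measure_display}
  {Z : measurableType d} {Omega : measurableType d'}.
Let T := T'.+1.
Variables (P : probability Z R) (Pr : probability Omega R).
Variables (S : 'I_n -> {RV Pr >-> Z}) (B : nat -> Omega -> 1.-tuple 'I_n).
Hypothesis smp : tsgd_sampling T P S B.
Variables (l : 'rV[R]_p -> Z -> R) (G L lstar : R).
Hypothesis lA : loss_assumptions l G L lstar.
Variables (eps : R) (eta : nat -> R) (w0 : 'rV[R]_p).
Hypothesis eta0 : forall t, (1 <= t <= T)%N -> 0 <= eta t.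
Variables (h : 'rV[R]_p -> Z -> R) (K : R).
Hypothesis K0 : 0 <= K.
Hypothesis mh : forall w, measurable_fun [set: Z] (h w).
Hypothesis lh : forall z w w', `|h w z - h w' z| <= K * norm2 (w - w').
Hypothesis hw0 : forall z, h w0 z = 0.
Hypothesis hP : forall w, \int[P]_z h w z = 0.
Variable b : {ffun 'I_T -> 'I_n}.

Definition draw_path (w : Omega) : 'rV[R]_p :=
  sgd_path l eps eta w0 (fun t => S (b (inord t)) w) T.

(* Example j is replaced by a constant, so that this path is independent of
   S j. *)
Definition draw_path_but (j : 'I_n) (w : Omega) : 'rV[R]_p :=
  sgd_path l eps eta w0
    (fun t => if b (inord t) == j then point else S (b (inord t)) w) T.

Let r : R := G * \sum_(1 <= s < T.+1) eta s.

Lemma centered_loss_norm_le v z : norm2 (v - w0) <= r -> `|h v z| <= K * r.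
Proof.
move=> vr; rewrite -[h v z]subr0 -(hw0 z) (le_trans (lh _ _ _))//.
by rewrite ler_wpM2l.
Qed.

Lemma draw_path_dist w : norm2 (draw_path w - w0) <= r.
Proof. exact: (sgd_path_dist_w0 lA). Qed.

Lemma draw_path_but_dist j w : norm2 (draw_path_but j w - w0) <= r.
Proof. exact: (sgd_path_dist_w0 lA). Qed.

Lemma draw_path_measurable i :
  measurable_fun [set: Omega] (fun w => draw_path w 0 i).
Proof.
apply: (sgd_path_measurable lA eps eta w0
  (X := fun t w => S (b (inord t)) w)) => s.
exact: measurable_funPT.
Qed.

Lemma draw_path_but_measurable j i :
  measurable_fun [set: g_sigma_algebraType (events_but (T := T) S B j)]
    (fun w => draw_path_but j w 0 i).
Proof.
apply: (sgd_path_measurable lA eps eta w0 (T := g_sigma_algebraType _)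
  (X := fun t w => if b (inord t) == j then point else S (b (inord t)) w)) => s.
by case: eqP => [_|/eqP bj]; [exact: measurable_cst|exact:
  example_measurable_but].
Qed.

Let prb : R := (n%:R ^+ T)^-1.
Let Db := draws B b.

Lemma draw_loss_measurable j :
  measurable_fun [set: Omega] (fun w => \1_Db w * h (draw_path w) (S j w)).
Proof.
apply: measurable_funM.
  by apply: measurable_indic; exact: (draws_measurable smp).
apply: (lipschitz_measurable_comp (F := h) (V := draw_path) mh lh) => //.
exact: draw_path_measurable.
Qed.

Lemma draw_loss_norm_le j w : `|\1_Db w * h (draw_path w) (S j w)| <= K * r.
Proof.
apply: indic_norm_le; apply: centered_loss_norm_le; exact: draw_path_dist.
Qed.

Lemma leave_one_out (j : 'I_n) (D : R) :
  (forall w, norm2 (draw_path w - draw_path_but j w) <= D) ->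
  \int[Pr]_w (\1_Db w * h (draw_path w) (S j w)) <= prb * (K * D).
Proof.
move=> WV.
pose H := g_sigma_algebraType (events_but (T := T) S B j).
(* The path and the indicator are read on [H], hence independent of S j; integrating z alone gives 0
   by [hP]. *)
pose F (x : H * Z) := \1_Db x.1 * h (draw_path_but j x.1) x.2.
have mF : measurable_fun [set: H * Z] F.
  apply: measurable_funM.
    have mI : measurable_fun [set: H] (\1_Db : H -> R) by exact:
      (draws_indic_measurable_but b).
    exact: (measurableT_comp mI measurable_fst).
  apply: (lipschitz_measurable_comp (F := h)
    (V := fun x : H * Z => draw_path_but j x.1) mh lh) => //.
  move=> i; have mV : measurable_fun [set: H] (fun w => draw_path_but j w 0 i).
    exact: draw_path_but_measurable.
  exact: (measurableT_comp mV measurable_fst).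
have FM x : `|F x| <= K * r.
  apply: indic_norm_le; apply: centered_loss_norm_le; exact: draw_path_but_dist.
have F0 : \int[Pr]_w F (w, S j w) <= \int[Pr]_w (cst 0 w).
  apply: (draws_Fubini smp mF FM (M' := 0)) => //.
    by move=> w; rewrite normr0.
  move=> w; rewrite /F/= RintegralZl//; last first.
    apply: (bounded_integrable (M := K * r)) => // z.
    by apply: centered_loss_norm_le; exact: draw_path_but_dist.
  by rewrite hP mulr0.
rewrite Rintegral_cst_probability in F0.
have mFS : measurable_fun [set: Omega] (fun w => F (w, S j w)).
  apply: (measurableT_comp mF).
  apply: measurable_fun_pair => //.
  exact: (measurable_to_sub (events_but_measurable smp (j := j))).
have mD : measurable_fun [set: Omega] (\1_Db : Omega -> R).
  by apply: measurable_indic; exact: (draws_measurable smp).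
have iD : Pr.-integrable [set: Omega] (EFin \o (fun w => (K * D) * \1_Db w)).
  apply: (bounded_integrable (M := `|K * D|)).
    exact: measurable_funM.
  by move=> w; rewrite mulrC; exact: indic_norm_le.
have iF : Pr.-integrable [set: Omega] (EFin \o (fun w => F (w, S j w))).
  exact: (bounded_integrable (M := K * r)).
rewrite (@le_trans _ _ (\int[Pr]_w (F (w, S j w) + K * D * \1_Db w)))//.
  apply: le_Rintegral.
  - exact: measurableT.
  - apply: bounded_integrable (draw_loss_norm_le _); exact:
    draw_loss_measurable.
  - exact: (integrableD _ iF iD).
  move=> w _; rewrite /F/= [K * D * _]mulrC -mulrDr ler_wpM2l//.
  rewrite -lerBlDl (le_trans (ler_norm _))// (le_trans (lh _ _ _))//.
  by rewrite ler_wpM2l.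
rewrite RintegralD// -[leRHS]add0r lerD//.
rewrite RintegralZl//.
  by rewrite (Rintegral_draws smp) mulrC.
by apply: (bounded_integrable (M := 1)) => // w; rewrite -[\1_Db w]mulr1;
  apply: indic_norm_le; rewrite normr1.
Qed.

End leave_one_out.

(** * Chaining *)

Section chaining.
Context {R : realType} {p : nat}.
Implicit Types (u v w : 'rV[R]_p) (r a : R).

Definition shift v a (e : {ffun 'I_p -> bool}) : 'rV[R]_p :=
  v + \row_j (if e j then a else - a).

(** Centers of the level-k dyadic subcubes, of half-side r / 2^k, of the cube of center [u] and
    half-side [r]; [e] selects one of the 2^p children. *)
Fixpoint net u r (k : nat) : seq 'rV[R]_p :=
  if k is k'.+1 then
    [seq shift v (r / 2 ^+ k'.+1) e | v <- net u r k', e <- enum {ffun 'I_p ->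
      bool}]
  else [:: u].

Lemma size_net u r k : size (net u r k) = ((2 ^ p) ^ k)%N.
Proof.
elim: k => [|k IH] //=.
by rewrite size_allpairs IH -cardE card_ffun card_bool card_ord expnSr.
Qed.

Lemma norm2_shift v a e : 0 <= a -> norm2 (shift v a e - v) <= p.+1%:R * a.
Proof.
move=> a0; rewrite /shift addrAC subrr add0r; apply: norm2_le_coord => // i.
by rewrite mxE; case: ifP => _; rewrite ?normrN ger0_norm.
Qed.

(** If x > a then (x / a)^q >= 1; otherwise the even power x^(q+1) is nonnegative. *)
Lemma le_add_exprn (q : nat) (x a : R) : ~~ odd q.+1 -> 0 < a ->
  x <= a + x ^+ q.+1 / a ^+ q.
Proof.
move=> qe a0; have xq : 0 <= x ^+ q.+1 by rewrite exprn_even_ge0.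
have [xa|ax] := leP x a; first by rewrite ler_wpDr// divr_ge0// exprn_ge0// ltW.
have x0 : 0 < x := lt_trans a0 ax.
rewrite ler_wpDl ?(ltW a0)// ler_pdivlMr ?exprn_gt0// exprS ler_wpM2l ?(ltW
  x0)//.
by rewrite lerXn2r ?nnegrE ?(ltW a0) ?(ltW x0) ?(ltW ax).
Qed.

(* By x <= a + x^(q+1)/a^q, the maximum of the increments of M over the links
   of level k is replaced by a sum, whose mean is controlled by moments. *)
Definition chain_increment (M : 'rV[R]_p -> R) (q : nat) u r a (k : nat) : R :=
  a + (\sum_(v <- net u r k) \sum_(e <- enum {ffun 'I_p -> bool})
    (M (shift v (r / 2 ^+ k.+1) e) - M v) ^+ q.+1) / a ^+ q.

Lemma net_approximation (M : 'rV[R]_p -> R) (q : nat) u r (a : nat -> R) w K :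
  ~~ odd q.+1 -> (forall k, 0 < a k) -> 0 <= r ->
  (forall j, `|w 0 j - u 0 j| <= r) ->
  exists v, [/\ v \in net u r K, forall j, `|w 0 j - v 0 j| <= r / 2 ^+ K &
    M v <= M u + \sum_(0 <= k < K) chain_increment M q u r (a k) k].
Proof.
move=> qe a0 r0 wu; elim: K => [|K [v [vK wv Mv]]].
  exists u; split; rewrite ?inE ?big_nil ?addr0//.
  by move=> j; rewrite expr0 divr1.
(* The child cube containing [w]: in each coordinate, the half on the side of [w]. *)
pose e : {ffun 'I_p -> bool} := [ffun j => v 0 j <= w 0 j].
pose s := r / 2 ^+ K.+1.
exists (shift v s e); split.
- by apply: allpairs_f => //; rewrite mem_enum.
- move=> j; rewrite !mxE ffunE.
  have := wv j; have -> : r / 2 ^+ K = s + s.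
    by rewrite /s exprS invfM; field; rewrite expf_neq0.
  rewrite !ler_norml -/s => /andP[h1 h2].
  by case: ifP => [h|/negbT]; [|rewrite -ltNge => h]; apply/andP; split; lra.
- rewrite big_nat_recr//= addrA.
  rewrite -[leLHS](subrKC (M v)) lerD//.
  rewrite (le_trans (le_add_exprn _ qe (a0 K)))// lerD2l ler_wpM2r//.
    by rewrite invr_ge0 exprn_ge0// ltW.
  have nn v' e' : 0 <= (M (shift v' s e') - M v') ^+ q.+1.
    by rewrite exprn_even_ge0.
  (* The single link followed by the path is one term of the sum over all links of the level; the
     others are even powers, hence nonnegative. *)
  rewrite (big_rem v)//= -[leLHS]addr0 lerD//; last first.
    by apply: sumr_ge0 => v' _; apply: sumr_ge0 => e' _; exact: nn.
  rewrite (big_rem e)/= ?mem_enum// lerDl.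
  by apply: sumr_ge0 => e' _; exact: nn.
Qed.

End chaining.

Lemma Rintegral_seq_sum {R : realType} {d : measure_display}
    {T : measurableType d} (Pr : probability T R) (I : Type) (s : seq I)
    (f : I -> T -> R) :
  (forall i, Pr.-integrable [set: T] (EFin \o f i)) ->
  \int[Pr]_x (\sum_(i <- s) f i x) = \sum_(i <- s) \int[Pr]_x f i x /\
  Pr.-integrable [set: T] (EFin \o (fun x => \sum_(i <- s) f i x)).
Proof.
move=> fi; elim: s => [|i s [IH1 IH2]].
  split.
    rewrite big_nil -[RHS](Rintegral_cst_probability (Pr := Pr)).
    by apply: eq_Rintegral => x _; rewrite big_nil.
  apply: (bounded_integrable (M := 0)) => [|x]; last by rewrite big_nil normr0.
  by under eq_fun do rewrite big_nil; exact: measurable_cst.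
have E : (fun x => \sum_(j <- i :: s) f j x) =
    (fun x => f i x + \sum_(j <- s) f j x).
  by apply/funext => x; rewrite big_cons.
rewrite E; split; last exact: (integrableD measurableT (fi i) IH2).
by rewrite RintegralD// IH1 big_cons.
Qed.

Lemma sum_seq_const {R : realType} (I : Type) (s : seq I) (x : R) :
  \sum_(i <- s) x = (size s)%:R * x.
Proof. by rewrite big_const_seq count_predT iter_addr_0 mulr_natl. Qed.

(** * Chaining bound for the drawn examples *)

Section deviation.
Context {R : realType} {p n T' : nat} {d d' : measure_display}
  {Z : measurableType d} {Omega : measurableType d'}.
Let T := T'.+1.
Variables (P : probability Z R) (Pr : probability Omega R).
Variables (S : 'I_n -> {RV Pr >-> Z}) (B : nat -> Omega -> 1.-tuple 'I_n).
Hypothesis smp : tsgd_sampling T P S B.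
Variables (l : 'rV[R]_p -> Z -> R) (G L lstar : R).
Hypothesis lA : loss_assumptions l G L lstar.
Variables (eps : R) (eta : nat -> R) (w0 : 'rV[R]_p).
Hypothesis eta0 : forall t, (1 <= t <= T)%N -> 0 <= eta t.
Variables (h : 'rV[R]_p -> Z -> R) (K : R).
Hypothesis K0 : 0 < K.
Hypothesis mh : forall w, measurable_fun [set: Z] (h w).
Hypothesis lh : forall z w w', `|h w z - h w' z| <= K * norm2 (w - w').
Hypothesis hw0 : forall z, h w0 z = 0.
Hypothesis hP : forall w, \int[P]_z h w z = 0.
Variable b : {ffun 'I_T -> 'I_n}.
Variable r : R.
Hypothesis r0 : 0 < r.
Hypothesis etar : G * \sum_(1 <= s < T.+1) eta s <= r.
Variable s : seq 'I_n.
Hypothesis us : uniq s.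
Hypothesis sT : (size s <= T)%N.

(** The moment order q + 1 = 2p + 2 is even and high enough to outweigh the 2^p children of every
    net point. *)
Let q := (2 * p).+1.
Let prb : R := (n%:R ^+ T)^-1.
Let Db := draws B b.
(** A link of level k has length at most (p+1) r / 2^(k+1); the factor 2 in [draws_moment] then
    makes D / 2^k the scale of its moments. *)
Let D : R := Num.sqrt T%:R * (K * (p.+1%:R * r)).
Let C : R := 2 * expR 1 * q.+1`!%:R.
(** The ratio 3/4 lies strictly between 1/2, the decay of the links, and 1: the level thresholds are
    summable and yet exceed typical increments by (3/2)^k. *)
Let a (k : nat) : R := D * (3 / 4) ^+ k.
Let M (w : Omega) (v : 'rV[R]_p) : R := \sum_(i <- s) h v (S i w).
Let X k v e (w : Omega) : R :=
  \1_Db w * (M w (shift v (r / 2 ^+ k.+1) e) - M w v) ^+ q.+1.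

Let T_gt0 : 0 < Num.sqrt T%:R :> R.
Proof. by rewrite sqrtr_gt0 ltr0n. Qed.

Let D_gt0 : 0 < D.
Proof. by rewrite !mulr_gt0. Qed.

Let a_gt0 k : 0 < a k.
Proof. by rewrite mulr_gt0// exprn_gt0//; lra. Qed.

Let mD : measurable_fun [set: Omega] (\1_Db : Omega -> R).
Proof. by apply: measurable_indic; exact: (draws_measurable smp). Qed.

Let iD : Pr.-integrable [set: Omega] (EFin \o (\1_Db : Omega -> R)).
Proof.
apply: (bounded_integrable (M := 1)) => // w.
by rewrite -[\1_Db w]mulr1; apply: indic_norm_le; rewrite normr1.
Qed.

Let link_bound k v e z :
  `|h (shift v (r / 2 ^+ k.+1) e) z - h v z| <= K * (p.+1%:R * (r / 2 ^+ k.+1)).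
Proof.
rewrite (le_trans (lh _ _ _))// ler_wpM2l ?(ltW K0)//.
by apply: norm2_shift; rewrite divr_ge0 ?(ltW r0)// exprn_ge0.
Qed.

Let mlink k v e :
  measurable_fun [set: Z] (fun z => h (shift v (r / 2 ^+ k.+1) e) z - h v z).
Proof. exact: measurable_funB. Qed.

Let XE k v e w : X k v e w =
  \1_Db w * (\sum_(i <- s) (h (shift v (r / 2 ^+ k.+1) e) (S i w) - h v (S i
    w))) ^+ q.+1.
Proof. by rewrite /X /M -sumrB. Qed.

Let iX k v e : Pr.-integrable [set: Omega] (EFin \o X k v e).
Proof.
rewrite (funext (XE k v e)).
apply: (bounded_integrable
  (M := (\sum_(i <- s) (K * (p.+1%:R * (r / 2 ^+ k.+1)))) ^+ q.+1)).
  apply: measurable_funM => //; apply: measurable_funX; apply: measurable_sum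
    => i.
  exact: (measurableT_comp (mlink k v e)).
move=> w; apply: indic_norm_le; rewrite normrX lerXn2r ?nnegrE//.
  by apply: sumr_ge0 => i _; rewrite !mulr_ge0 ?invr_ge0 ?exprn_ge0 ?(ltW K0)
    ?(ltW r0).
rewrite (le_trans (ler_norm_sum _ _ _))//; apply: ler_sum => i _; exact:
  link_bound.
Qed.

Let q_even : ~~ odd q.+1.
Proof. by rewrite /q /= negbK oddM. Qed.

Let Xint k v e : \int[Pr]_w X k v e w <= prb * (C * (D / 2 ^+ k) ^+ q.+1).
Proof.
rewrite (eq_Rintegral _ (fun w _ => XE k v e w)).
have ih u : P.-integrable [set: Z] (EFin \o h u).
  apply: (bounded_integrable (M := K * norm2 (u - w0))) => // z.
  by rewrite -[h u z]subr0 -(hw0 z).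
have b0 : 0 < K * (p.+1%:R * (r / 2 ^+ k.+1)).
  by rewrite !mulr_gt0// invr_gt0 exprn_gt0.
rewrite (le_trans (draws_moment smp b _ us sT q_even b0 (mlink k v e)
  (link_bound k v e) _))//.
  by rewrite RintegralB// !hP subrr.
rewrite le_eqVlt; apply/orP; left; apply/eqP; congr (_ * (_ * _ ^+ _)).
by rewrite /D exprS; field; rewrite expf_neq0.
Qed.

(** Level k has (2^p)^(k+1) links. Since a_k = (D / 2^k) (3/2)^k, the claim reduces to 2^p <=
    (3/2)^(q+1) = (9/4)^(p+1); the one spare factor 2^p goes into the constant. *)
Let level_bound k :
  (2 ^ p)%:R ^+ k.+1 * (C * (D / 2 ^+ k) ^+ q.+1) / a k ^+ q <=
  C * 2 ^+ p * a k.
Proof.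
have C0 : 0 <= C by rewrite !mulr_ge0// ?expR_ge0// ler0n.
rewrite ler_pdivrMr ?exprn_gt0// natrX exprS.
have -> : C * 2 ^+ p * a k * a k ^+ q = C * 2 ^+ p * a k ^+ q.+1.
  by rewrite exprS; ring.
have -> : 2 ^+ p * (2 ^+ p) ^+ k * (C * (D / 2 ^+ k) ^+ q.+1) =
    C * 2 ^+ p * ((2 ^+ p) ^+ k * (D / 2 ^+ k) ^+ q.+1) by ring.
rewrite ler_wpM2l ?mulr_ge0 ?exprn_ge0//.
have -> : a k = D / 2 ^+ k * (3 / 2) ^+ k.
  rewrite /a -mulrA; congr (_ * _); rewrite -exprVn -exprMn; congr (_ ^+ _).
  by field.
rewrite [leRHS]exprMn mulrC ler_wpM2l//.
  by rewrite exprn_ge0// divr_ge0 ?(ltW D_gt0)// exprn_ge0.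
have h32 : 0 <= 3 / 2 :> R by lra.
rewrite [leRHS]exprAC; apply: lerXn2r; rewrite ?nnegrE ?exprn_ge0 ?h32//.
have -> : q.+1 = (2 * p.+1)%N by rewrite /q mulnS.
rewrite exprM (@le_trans _ _ (2 ^+ p.+1))//.
  by rewrite ler_eXn2l//; lra.
by rewrite ler_pXn2r ?nnegrE//; lra.
Qed.

Let geometric m : \sum_(0 <= k < m) a k <= 4 * D.
Proof.
suff -> : \sum_(0 <= k < m) a k = 4 * D * (1 - (3 / 4) ^+ m).
  have D4 : 0 <= 4 * D by rewrite mulr_ge0 ?(ltW D_gt0).
  rewrite ler_piMr// gerBl exprn_ge0//; lra.
elim: m => [|m IH]; first by rewrite big_nil expr0 subrr mulr0.
by rewrite big_nat_recr//= IH /a exprS; field.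
Qed.

Let W := draw_path S l eps eta w0 b.

(** The chain stops at depth T: the last net point is within r / 2^T of the path in every
    coordinate, and at most T <= 2^T terms are summed, so the remainder is at most K (p+1) r <=
    D. *)
Let pointwise_chaining w : M w (W w) <= D +
  \sum_(0 <= k < T) chain_increment (M w) q w0 r (a k) k.
Proof.
have Wr j : `|W w 0 j - w0 0 j| <= r.
  have := coord_le_norm2 (W w - w0) j; rewrite !mxE => /le_trans; apply.
  exact: le_trans (draw_path_dist S lA eps w0 eta0 b w) etar.
have [v [_ wv Mv]] := net_approximation (M w) T q_even a_gt0 (ltW r0) Wr.
have M0 : M w w0 = 0 by rewrite /M big1// => i _; rewrite hw0.
rewrite M0 add0r in Mv.
rewrite -[leLHS](subrKC (M w v)) addrC lerD//.
rewrite /M -sumrB.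
apply: (@le_trans _ _ (\sum_(i <- s) (K * (p.+1%:R * (r / 2 ^+ T))))).
  apply: ler_sum => i _; rewrite (le_trans (ler_norm _))// (le_trans (lh _ _
    _))//.
  rewrite ler_wpM2l ?(ltW K0)//; apply: norm2_le_coord => [|j].
    by rewrite divr_ge0 ?(ltW r0)// exprn_ge0.
  by rewrite mxE [X in _ + X]mxE; exact: wv.
rewrite sum_seq_const /D.
have T2 : T%:R <= 2 ^+ T :> R by rewrite -natrX ler_nat ltnW// ltn_expl.
have sT2 : (size s)%:R / 2 ^+ T <= 1 :> R.
  by rewrite ler_pdivrMr ?exprn_gt0// mul1r (le_trans _ T2)// ler_nat.
have T1 : 1 <= Num.sqrt T%:R :> R by rewrite -[leLHS]sqrtr1 ler_wsqrtr// ler1n.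
have -> : (size s)%:R * (K * (p.+1%:R * (r / 2 ^+ T))) =
   ((size s)%:R / 2 ^+ T) * (K * (p.+1%:R * r)) by ring.
rewrite ler_wpM2r ?(le_trans sT2)//.
by rewrite !mulr_ge0 ?(ltW K0) ?(ltW r0).
Qed.

(** On the draw event, level k costs at most (1 + C 2^p) a_k in mean; the a_k sum to at most 4 D,
    and the remainder of the chain adds D. *)
Lemma sampled_deviation :
  \int[Pr]_w (\1_Db w *
     \sum_(i <- s) h (draw_path S l eps eta w0 b w) (S i w)) <=
  prb * ((4 * (1 + C * 2 ^+ p) + 1) * D).
Proof.
pose Y k w := \sum_(v <- net w0 r k)
  \sum_(e <- enum {ffun 'I_p -> bool}) X k v e w.
have iY k : \int[Pr]_w Y k w = \sum_(v <- net w0 r k)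
    \sum_(e <- enum {ffun 'I_p -> bool}) \int[Pr]_w X k v e w /\
    Pr.-integrable [set: Omega] (EFin \o Y k).
  have [] := Rintegral_seq_sum (net w0 r k) (fun v => (Rintegral_seq_sum
    (enum {ffun 'I_p -> bool}) (fun e => iX k v e)).2).
  rewrite /Y => -> iYk; split => //; apply: eq_bigr => v _.
  by rewrite (Rintegral_seq_sum _ (fun e => iX k v e)).1.
have Yint k : \int[Pr]_w Y k w <=
    prb * ((2 ^ p)%:R ^+ k.+1 * (C * (D / 2 ^+ k) ^+ q.+1)).
  rewrite (iY k).1 (@le_trans _ _ (\sum_(v <- net w0 r k)
      \sum_(e <- enum {ffun 'I_p -> bool}) (prb * (C * (D / 2 ^+ k) ^+
        q.+1))))//.
    by apply: ler_sum => v _; apply: ler_sum => e _; exact: Xint.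
  rewrite !sum_seq_const size_net -cardE card_ffun card_bool card_ord.
  rewrite le_eqVlt; apply/orP; left; apply/eqP.
  by rewrite [in LHS]natrX [in RHS]exprS; ring.
pose V k w := a k * \1_Db w + (a k ^+ q)^-1 * Y k w.
have iV1 k : Pr.-integrable [set: Omega] (EFin \o (fun w => a k * \1_Db w)).
  exact: (integrableZl measurableT (a k) iD).
have iV2 k : Pr.-integrable [set: Omega] (EFin \o (fun w => (a k ^+ q)^-1 * Y k
  w)).
  exact: (integrableZl measurableT _ (iY k).2).
have iV k : Pr.-integrable [set: Omega] (EFin \o V k).
  exact: (integrableD measurableT (iV1 k) (iV2 k)).
have Vint k : \int[Pr]_w V k w <= prb * ((1 + C * 2 ^+ p) * a k).
  rewrite RintegralD// RintegralZl// RintegralZl//; last exact: (iY k).2.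
  rewrite (Rintegral_draws smp) -/prb.
  have -> : prb * ((1 + C * 2 ^+ p) * a k) = a k * prb + prb * (C * 2 ^+ p * a
    k).
    by ring.
  rewrite lerD2l (le_trans (ler_wpM2l _ (Yint k)))//.
    by rewrite invr_ge0 exprn_ge0// ltW.
  rewrite mulrCA ler_wpM2l ?invr_ge0 ?exprn_ge0// mulrC; exact: level_bound.
have [sV1 sV2] := Rintegral_seq_sum (index_iota 0 T) iV.
have iDD : Pr.-integrable [set: Omega] (EFin \o (fun w => D * \1_Db w)).
  exact: (integrableZl measurableT D iD).
have iL i : Pr.-integrable [set: Omega]
    (EFin \o (fun w => \1_Db w * h (W w) (S i w))).
  apply: (bounded_integrable (M := K * (G * \sum_(1 <= s < T.+1) eta s))).
    exact: (draw_loss_measurable smp lA eps eta w0 mh lh).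
  exact: (draw_loss_norm_le S B lA eps eta0 (ltW K0) lh hw0).
rewrite (@le_trans _ _ (\int[Pr]_w (D * \1_Db w +
    \sum_(k <- index_iota 0 T) V k w)))//.
  apply: le_Rintegral => //.
  - have [_] := Rintegral_seq_sum s iL.
    suff -> : (fun w => \sum_(i <- s) \1_Db w * h (W w) (S i w)) =
      (fun w => \1_Db w * \sum_(i <- s) h (W w) (S i w)) by [].
    by apply/funext => w; rewrite mulr_sumr.
  - exact: (integrableD measurableT iDD sV2).
  move=> w _.
  have -> : D * \1_Db w + \sum_(k <- index_iota 0 T) V k w = \1_Db w *
      (D + \sum_(0 <= k < T) chain_increment (M w) q w0 r (a k) k).
    rewrite mulrDr mulrC; congr (_ + _).
    rewrite mulr_sumr; apply: eq_bigr => k _.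
    rewrite /V /chain_increment mulrDr [in RHS]mulrC; congr (_ + _).
    rewrite mulrA [in RHS]mulrC; congr (_ * _).
    rewrite mulr_sumr; apply: eq_bigr => v _.
    by rewrite mulr_sumr; apply: eq_bigr => e _.
  by rewrite ler_wpM2l//; exact: pointwise_chaining.
rewrite RintegralD// RintegralZl// (Rintegral_draws smp) -/prb sV1.
have pr0 : 0 <= prb by rewrite invr_ge0 exprn_ge0.
rewrite (@le_trans _ _ (D * prb +
    \sum_(k <- index_iota 0 T) prb * ((1 + C * 2 ^+ p) * a k)))//.
  by rewrite lerD2l; apply: ler_sum => k _; exact: Vint.
rewrite -mulr_sumr -mulr_sumr mulrC -mulrDr ler_wpM2l//.
have c0 : 0 <= 1 + C * 2 ^+ p.
  by rewrite addr_ge0// mulr_ge0 ?exprn_ge0// !mulr_ge0// ?expR_ge0 ?ler0n.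
have := ler_wpM2l c0 (geometric T).
move: (1 + C * 2 ^+ p) (index_iota 0 T) => c I; move: (\sum_(k <- I) a k) => A.
by move=> cA; lra.
Qed.

End deviation.

(** * Stability under the replacement of one example *)

(** ln ((t+1)/t) = - ln (1 - 1/(t+1)) >= 1/(t+1). These factors telescope, which yields growth like
    (t / t0)^a. *)
Lemma step_growth_le {R : realType} (a : R) (t : nat) : 0 <= a -> (0 < t)%N ->
  1 + a / t.+1%:R <= (t.+1%:R / t%:R) `^ a.
Proof.
move=> a0 t0.
have tR : 0 < t%:R :> R by rewrite ltr0n.
have t1R : 0 < t.+1%:R :> R by rewrite ltr0n.
rewrite /powR gt_eqF ?divr_gt0// (le_trans (expR_ge1Dx _))// ler_expR.
rewrite ler_wpM2l// -[t.+1%:R / _]invrK lnV ?posrE ?invr_gt0 ?divr_gt0//.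
rewrite lerNr invf_div.
have -> : t%:R / t.+1%:R = 1 + - t.+1%:R^-1 :> R.
  by rewrite -[t.+1]addn1 natrD; field; apply: lt0r_neq0; lra.
by apply: le_ln1Dx; rewrite ltrN2 invf_lt1// ltr1n.
Qed.

Lemma sub_half_le (m : nat) : (m - m./2 <= m./2.+1)%N.
Proof. have := odd_double_half m; lia. Qed.

Lemma half_double_le (m : nat) : (2 * m./2 <= m)%N.
Proof. have := odd_double_half m; lia. Qed.

(** * Averages over uniform draws *)

Section uniform_draws.
Context {R : realType} {n T' : nat}.
Let T := T'.+1.
Implicit Types (b : {ffun 'I_T -> 'I_n}) (i : 'I_n).

(** The weight n^-T is the probability of each event [draws B b], so this is the expectation over
    the draws. *)
Definition avg (f : {ffun 'I_T -> 'I_n} -> R) : R :=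
  \sum_b (n%:R ^+ T)^-1 * f b.

Lemma le_avg f g : (forall b, f b <= g b) -> avg f <= avg g.
Proof.
by move=> fg; apply: ler_sum => b _; rewrite ler_wpM2l// invr_ge0 exprn_ge0.
Qed.

Lemma avgD f g : avg (fun b => f b + g b) = avg f + avg g.
Proof. by rewrite /avg -big_split; apply: eq_bigr => b _; rewrite mulrDr. Qed.

Lemma avgZ (x : R) f : avg (fun b => x * f b) = x * avg f.
Proof. by rewrite /avg mulr_sumr; apply: eq_bigr => b _; rewrite mulrCA. Qed.

Lemma avg_sum (I : Type) (s : seq I) (f : I -> {ffun 'I_T -> 'I_n} -> R) :
  avg (fun b => \sum_(k <- s) f k b) = \sum_(k <- s) avg (f k).
Proof.
rewrite /avg exchange_big/=; apply: eq_bigr => b _.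
by rewrite mulr_sumr.
Qed.

Lemma avg_cst (x : R) : (0 < n)%N -> avg (fun=> x) = x.
Proof.
move=> n0; rewrite /avg sumr_const card_ffun !card_ord -[LHS]mulr_natl natrX
  mulrA.
by rewrite mulfV ?mul1r// expf_neq0// pnatr_eq0 -lt0n.
Qed.

(** Transposing two values of draw t preserves the average, so the n frequencies are equal; they sum
    to 1. *)
Lemma avg_draw (t : 'I_T) i : avg (fun b => (b t == i)%:R) = n%:R^-1.
Proof.
have n0 : (0 < n)%N by case: i => k /=; case: (n).
have same k : avg (fun b => (b t == k)%:R) = avg (fun b => (b t == i)%:R).
  pose f b : {ffun 'I_T -> 'I_n} :=
    [ffun s => if s == t then tperm i k (b s) else b s].
  have fK : involutive f.
    move=> b; apply/ffunP => s; rewrite !ffunE.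
    by case: eqP => // _; rewrite tpermK.
  rewrite /avg (reindex_inj (inv_inj fK)); apply: eq_bigr => b _.
  rewrite ffunE eqxx; congr (_ * _%:R).
  by rewrite -[in RHS](inj_eq (@perm_inj _ (tperm i k))) tpermL.
have : avg (fun b => \sum_(k <- enum 'I_n) (b t == k)%:R) = 1.
  rewrite -[RHS](avg_cst 1 n0); congr avg; apply/funext => b.
  rewrite big_enum/= (bigD1 (b t))//= eqxx big1 ?addr0// => k kb.
  by rewrite eq_sym (negbTE kb).
rewrite avg_sum (eq_bigr _ (fun k _ => same k)) big_enum/= sumr_const card_ord.
move=> h; apply: (mulfI (x := n%:R)); first by rewrite pnatr_eq0 -lt0n.
by rewrite mulr_natl h mulfV// pnatr_eq0 -lt0n.
Qed.

End uniform_draws.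

(** * Mean distance between runs differing in one example *)

Section gap.
Context {R : realType} {n T' : nat}.
Let T := T'.+1.
Variables (L c eps kappa : R) (i : 'I_n).
Hypotheses (L0 : 0 < L) (c0 : 0 < c) (eps0 : 0 <= eps) (kappa0 : 0 <= kappa).
Implicit Types b : {ffun 'I_T -> 'I_n}.

(** Past the last draw [inord] falls back on the first one. The averages below remain valid for all
    t, as they use only the law of each single draw. *)
Fixpoint selected b (t : nat) : bool :=
  if t is t'.+1 then selected b t' || (b (inord t') == i) else false.

(* Deterministic majorant, given the draws b, of the distance between two runs
   whose data sets differ only at example i. Truncation is discontinuous, but as
   long as i has not been drawn the two runs coincide exactly, so that its error
   kappa * eps only enters afterwards. *)
Fixpoint gap b (t : nat) : R :=
  if t is t'.+1 then
    let g := gap b t' in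
    if b (inord t') == i then g + c / t'.+1%:R * kappa
    else if selected b t' then
      g + c / t'.+1%:R * Num.min (L * g + kappa * eps) kappa
    else 0
  else 0.

Let n0 : (0 < n)%N.
Proof. by case: i => k /=; case: (n). Qed.

Let eta0 (t : nat) : 0 <= c / t.+1%:R :> R.
Proof. by rewrite divr_ge0// ltW. Qed.

Lemma gap_ge0 b t : 0 <= gap b t.
Proof.
elim: t => //= t IH; case: ifP => _; first by rewrite addr_ge0// mulr_ge0.
case: ifP => // _; rewrite addr_ge0// mulr_ge0// le_min kappa0 andbT.
by rewrite addr_ge0// mulr_ge0// ltW.
Qed.

Lemma selected_mono b s t : (s <= t)%N -> selected b s -> selected b t.
Proof.
elim: t => [|t IH]; first by rewrite leqn0 => /eqP ->.
by rewrite leq_eqVlt => /predU1P[-> //|st ss]; rewrite /= IH.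
Qed.

Lemma gap_unselected b t : ~~ selected b t -> gap b t = 0.
Proof.
elim: t => //= t IH; rewrite negb_or => /andP[/negbTE -> /negbTE ->] //.
Qed.

Lemma gap_step_le b t : gap b t.+1 <= gap b t + c / t.+1%:R * kappa.
Proof.
rewrite /=; case: ifP => // _; case: ifP => _.
  by rewrite lerD2l ler_wpM2l// ge_min lexx orbT.
by rewrite addr_ge0 ?gap_ge0// mulr_ge0.
Qed.

Lemma gap_step_growth b t : gap b t.+1 <=
  gap b t * (1 + L * c / t.+1%:R) + c / t.+1%:R * (kappa * eps)
  + c / t.+1%:R * kappa * (b (inord t) == i)%:R.
Proof.
have g0 := gap_ge0 b t.
have Lg : 0 <= gap b t * (L * c / t.+1%:R).
  by rewrite !mulr_ge0// ?invr_ge0 ?(ltW L0) ?(ltW c0).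
have ke : 0 <= c / t.+1%:R * (kappa * eps) by rewrite !mulr_ge0 ?invr_ge0 ?(ltW
  c0).
rewrite /= mulrDr mulr1; case: ifP => _.
  by rewrite mulr1 lerD2r -addrA lerDl addr_ge0.
rewrite mulr0 addr0; case: ifP => _; last by rewrite !addr_ge0.
rewrite -addrA lerD2l.
have -> : gap b t * (L * c / t.+1%:R) + c / t.+1%:R * (kappa * eps) =
  c / t.+1%:R * (L * gap b t + kappa * eps) by ring.
by rewrite ler_wpM2l// ge_min lexx.
Qed.

Lemma avg_selected t : avg (fun b => (selected b t)%:R) <= t%:R / n%:R :> R.
Proof.
elim: t => [|t IH] /=; first by rewrite avg_cst// mul0r.
apply: (@le_trans _ _ (avg (fun b => (selected b t)%:R + (b (inord t) ==
  i)%:R))).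
  by apply: le_avg => b; case: selected; case: eqP => _; rewrite ?addr0
    ?add0r// lerDl.
have -> : t.+1%:R / n%:R = t%:R / n%:R + n%:R^-1 :> R.
  by rewrite -natr1 mulrDl mul1r.
by rewrite avgD avg_draw lerD2r.
Qed.

(** On this event the gap is 0 at time t0; from then on its mean satisfies an affine recursion with
    factor 1 + Lc/(t+1). *)
Lemma avg_gap_unselected (t0 t : nat) : (0 < t0)%N -> (t0 <= t)%N ->
  avg (fun b => gap b t * (~~ selected b t0)%:R) <=
  kappa * (eps + n%:R^-1) / L * (t%:R / t0%:R) `^ (L * c).
Proof.
move=> t0_gt0.
(* - K is the fixed point of every step of the affine recursion; adding K makes the recursion purely
   multiplicative. *)
set K := kappa * (eps + n%:R^-1) / L.
have K0 : 0 <= K.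
  by rewrite !mulr_ge0 ?invr_ge0 ?(ltW L0)// addr_ge0// invr_ge0.
have a0 : 0 <= L * c by rewrite mulr_ge0// ltW.
have t0R : 0 < t0%:R :> R by rewrite ltr0n.
suff H : (t0 <= t)%N -> avg (fun b => gap b t * (~~ selected b t0)%:R) + K <=
    K * (t%:R / t0%:R) `^ (L * c).
  by move=> t0t; rewrite (le_trans _ (H t0t))// lerDl.
elim: t => [|t IH]; first by rewrite leqNgt t0_gt0.
rewrite leq_eqVlt => /predU1P[<-|].
  rewrite divff ?gt_eqF// powR1 mulr1 gerDr.
  apply: (@le_trans _ _ (avg (fun _ : {ffun 'I_T -> 'I_n} => 0)));
    last by rewrite avg_cst.
  apply: le_avg => b; case: (boolP (selected b t0)) => [_|h]; first by rewrite
    mulr0.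
  by rewrite gap_unselected// mul0r.
rewrite ltnS => t0t; have {}IH := IH t0t.
have t_gt0 : (0 < t)%N by exact: leq_trans t0t.
have tR : 0 < t%:R :> R by rewrite ltr0n.
apply: (@le_trans _ _ (avg (fun b => (1 + L * c / t.+1%:R) *
    (gap b t * (~~ selected b t0)%:R) + (c / t.+1%:R * (kappa * eps)
    + c / t.+1%:R * kappa * (b (inord t) == i)%:R)) + K)).
  rewrite lerD2r; apply: le_avg => b.
  have [->|->] : (~~ selected b t0)%:R = 0 :> R \/ (~~ selected b t0)%:R = 1 :>
    R.
    by case: selected; [left|right].
    by rewrite !mulr0 add0r addr_ge0// !mulr_ge0 ?invr_ge0 ?(ltW c0).
  by rewrite !mulr1 addrA [X in _ <= X + _ + _]mulrC gap_step_growth.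
rewrite avgD avgD !avgZ avg_cst// avg_draw.
have -> : (t.+1%:R / t0%:R) `^ (L * c) =
    (t%:R / t0%:R) `^ (L * c) * (t.+1%:R / t%:R) `^ (L * c) :> R.
  rewrite -powRM ?divr_ge0//; congr (_ `^ _); field.
  by rewrite !lt0r_neq0.
set A := avg _ in IH *.
have -> : (1 + L * c / t.+1%:R) * A +
   (c / t.+1%:R * (kappa * eps) + c / t.+1%:R * kappa / n%:R) + K =
   (1 + L * c / t.+1%:R) * (A + K).
  rewrite /K; field; rewrite !lt0r_neq0// ?ltr0n//; lra.
rewrite mulrC mulrA ler_pM//.
- rewrite addr_ge0//; apply: sumr_ge0 => b _.
  by rewrite !mulr_ge0 ?gap_ge0// invr_ge0 exprn_ge0.
- by rewrite addr_ge0// divr_ge0.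
- by apply: step_growth_le.
Qed.

(** After time s only the crude increment c kappa / (s+1) per step is used, weighted by the
    probability t0 / n of the event; at time s the event is dropped. *)
Lemma avg_gap_selected (t0 s t : nat) : (s <= t)%N ->
  avg (fun b => gap b t * (selected b t0)%:R) <=
  avg (fun b => gap b s) + (t - s)%:R / s.+1%:R * (c * kappa * (t0%:R / n%:R)).
Proof.
have ck : 0 <= c * kappa by rewrite mulr_ge0// ltW.
have K0 : 0 <= c * kappa * (t0%:R / n%:R) by rewrite mulr_ge0// divr_ge0.
elim: t => [|t IH].
  rewrite leqn0 => /eqP ->; rewrite mul0r mul0r addr0; apply: le_avg => b.
  by rewrite mul0r.
rewrite leq_eqVlt => /predU1P[->|].
  rewrite subnn mul0r mul0r addr0; apply: le_avg => b.
  by rewrite ler_piMr ?gap_ge0//; case: selected.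
rewrite ltnS => st; have {}IH := IH st.
apply: (@le_trans _ _ (avg (fun b => gap b t * (selected b t0)%:R +
    c / t.+1%:R * kappa * (selected b t0)%:R))).
  apply: le_avg => b; rewrite -mulrDl ler_wpM2r//; exact: gap_step_le.
rewrite avgD avgZ subSn// -[(t - s).+1%:R]natr1 2!mulrDl addrA lerD//.
have -> : c / t.+1%:R * kappa = t.+1%:R^-1 * (c * kappa) by ring.
have A0 : 0 <= avg (fun b => (selected b t0)%:R) :> R.
  by apply: sumr_ge0 => b _; rewrite mulr_ge0// invr_ge0 exprn_ge0.
rewrite mul1r -[leLHS]mulrA ler_pM//.
- by rewrite mulr_ge0.
- by rewrite lef_pV2 ?posrE ?ltr0n// ler_nat ltnS.
- by rewrite ler_wpM2l// avg_selected.
Qed.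

(* Split according to whether i is among the first t0 ~ t^q draws. If not,
   the distance grows at most like (t / t0)^(Lc), which is t^q. If so (an event
   of probability at most t0 / n), going from t/2 to t costs O(1). Hence
   e(t) <= e(t/2) + O(t^q / n), a geometric recursion: this is what avoids the
   logarithm that a single split would produce. *)
Let q : R := 1 - 1 / (L * c + 1).

Lemma avg_gap_le (c' : R) : eps <= c' / n%:R ->
  forall t, avg (fun b => gap b t) <=
    (2 * c + (c' + 1) / L) / (1 - 2^-1 `^ q) * (kappa / n%:R) * t%:R `^ q.
Proof.
move=> epsc.
have a0 : 0 < L * c by rewrite mulr_gt0.
have qE : q = L * c / (L * c + 1) by rewrite /q; field; apply: lt0r_neq0; lra.
have q0 : 0 < q by rewrite qE divr_gt0//; lra.
have q1 : q < 1 by rewrite qE ltr_pdivrMr; lra.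
have oneq : 1 `^ q = 1 :> R by rewrite powR1.
have h1 : (2^-1 : R) `^ q < 1.
  by rewrite -[ltRHS]oneq gt0_ltr_powR ?nnegrE ?invr_ge0//; lra.
set C := _ / (1 - _).
have n0R : 0 < n%:R :> R by rewrite ltr0n.
have k0 : 0 <= kappa / n%:R by rewrite divr_ge0.
have c'0 : 0 <= c' by have := le_trans eps0 epsc; rewrite pmulr_lge0// invr_gt0.
(* [C] solves C = C 2^-q + 2c + (c'+1)/L, the balance of the halving recursion. *)
have CE : 2 * c + (c' + 1) / L = C * (1 - 2^-1 `^ q).
  by rewrite /C -mulrA mulVf ?mulr1// subr_eq0 gt_eqF.
have C0 : 0 <= C.
  by rewrite divr_ge0// ?subr_ge0 ?(ltW h1)// addr_ge0 ?divr_ge0 ?addr_ge0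
    ?mulr_ge0
    ?(ltW c0) ?(ltW L0).
move: C CE C0 => C CE C0; elim/ltn_ind => -[_|t IH].
  by rewrite /= avg_cst// !mulr_ge0 ?powR_ge0 ?invr_ge0.
set m := t.+1.
have m1 : 1 <= m%:R :> R by rewrite ler1n.
have mq1 : 1 <= m%:R `^ q by rewrite -[leLHS]oneq ge0_ler_powR ?nnegrE// ltW.
(* Rounding up keeps t0 positive and, since m^q >= 1, at most 2 m^q. *)
pose t0 := (Num.truncn (m%:R `^ q)).+1.
have t0l : m%:R `^ q <= t0%:R by rewrite ltW// truncnS_gt.
have t0u : t0%:R <= 2 * m%:R `^ q.
  have := @truncn_le R (m%:R `^ q); rewrite powR_ge0 /t0 -natr1; lra.
have E : avg (fun b => gap b m) = avg (fun b => gap b m * (selected b t0)%:R) +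
    avg (fun b => gap b m * (~~ selected b t0)%:R).
  rewrite -avgD; congr avg; apply/funext => b.
  by case: selected; rewrite /= ?mulr1 ?mulr0 ?addr0 ?add0r.
have Funs : avg (fun b => gap b m * (~~ selected b t0)%:R) <=
    (c' + 1) / L * (kappa / n%:R) * m%:R `^ q.
  have [t0m|mt0] := leqP t0 m; last first.
    apply: (@le_trans _ _ (avg (fun _ : {ffun 'I_T -> 'I_n} => 0))).
      apply: le_avg => b; case: (boolP (selected b t0)) => [_|h].
        by rewrite mulr0.
      rewrite gap_unselected ?mul0r//; apply: contraNN h.
      by apply: selected_mono; exact: ltnW.
    rewrite avg_cst// !mulr_ge0 ?powR_ge0 ?addr_ge0 ?invr_ge0//; exact: ltW.
  rewrite (le_trans (avg_gap_unselected _ t0m))//.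
  apply: ler_pM; rewrite ?powR_ge0//.
  - by rewrite !mulr_ge0 ?invr_ge0 ?(ltW L0)// addr_ge0// invr_ge0.
  - have -> : (c' + 1) / L * (kappa / n%:R) = kappa * (c' / n%:R + n%:R^-1) / L.
      by ring.
    by rewrite ler_wpM2r ?invr_ge0 ?(ltW L0)// ler_wpM2l// lerD2r.
  (* This identity fixes the exponent: (m / t0)^(Lc) <= m^((1-q) Lc) is again of order m^q, like
     t0. *)
  have -> : q = (1 - q) * (L * c) by rewrite qE; field; apply: lt0r_neq0; lra.
  rewrite [leRHS]powRrM ge0_ler_powR ?nnegrE ?(ltW a0) ?powR_ge0 ?divr_ge0//.
  rewrite ler_pdivrMr ?ltr0n// -[leLHS]powRr1//.
  rewrite [X in _ `^ X <= _](_ : 1 = (1 - q) + q); last by ring.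
  rewrite powRD; last by apply/implyP => _; rewrite pnatr_eq0.
  by rewrite ler_wpM2l ?powR_ge0.
have Fsel : avg (fun b => gap b m * (selected b t0)%:R) <=
    C * (kappa / n%:R) * (2^-1 `^ q * m%:R `^ q) + 2 * c * (kappa / n%:R) *
      m%:R `^ q.
  have mh : (m./2 <= m)%N by rewrite -divn2 leq_div.
  rewrite (le_trans (avg_gap_selected t0 mh))// lerD//.
    have hm : (m./2 < m)%N by rewrite -divn2 ltn_Pdiv.
    rewrite (le_trans (IH _ hm))// ler_wpM2l ?mulr_ge0//.
    rewrite -powRM ?invr_ge0// ge0_ler_powR ?nnegrE ?mulr_ge0 ?invr_ge0// ?(ltW
      q0)//.
    by rewrite ler_pdivlMl// -natrM ler_nat half_double_le.
  have mm : (m - m./2)%:R / m./2.+1%:R <= 1 :> R.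
    by rewrite ler_pdivrMr ?ltr0n// mul1r ler_nat sub_half_le.
  have ckt : 0 <= c * kappa * (t0%:R / n%:R).
    by rewrite !mulr_ge0 ?invr_ge0 ?(ltW c0).
  rewrite (le_trans (ler_wpM2r ckt mm))// mul1r.
  have -> : 2 * c * (kappa / n%:R) * m%:R `^ q = c * kappa / n%:R * (2 * m%:R
    `^ q).
    by ring.
  have -> : c * kappa * (t0%:R / n%:R) = c * kappa / n%:R * t0%:R by ring.
  by rewrite ler_wpM2l// !mulr_ge0 ?invr_ge0 ?(ltW c0).
rewrite E (le_trans (lerD Fsel Funs))//.
rewrite le_eqVlt; apply/orP; left; apply/eqP.
transitivity ((C * 2^-1 `^ q + (2 * c + (c' + 1) / L)) * (kappa / n%:R) * m%:R
  `^ q).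
  ring.
by rewrite CE; ring.
Qed.

End gap.

Section path_gap.
Context {R : realType} {p n T' : nat} {d d' : measure_display}
  {Z : measurableType d} {Omega : measurableType d'}.
Let T := T'.+1.
Variables (Pr : probability Omega R) (S : 'I_n -> {RV Pr >-> Z}).
Variables (l : 'rV[R]_p -> Z -> R) (G L lstar : R).
Hypothesis lA : loss_assumptions l G L lstar.
Variables (c eps : R) (eta : nat -> R) (w0 : 'rV[R]_p).
Hypotheses (L0 : 0 < L) (c0 : 0 < c) (eps0 : 0 <= eps) (G0 : 0 <= G).
Hypothesis etaE : forall t, (1 <= t <= T)%N -> eta t = c / t%:R.
Variables (b : {ffun 'I_T -> 'I_n}) (j : 'I_n).

Lemma draw_path_dist_le_gap w :
  norm2 (draw_path S l eps eta w0 b w - draw_path_but S l eps eta w0 b j w)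
  <= gap L c eps (2 * G) j b T.
Proof.
pose x t := S (b (inord t)) w.
pose y t := if b (inord t) == j then point else x t.
suff H t : (t <= T)%N ->
    norm2 (sgd_path l eps eta w0 x t - sgd_path l eps eta w0 y t) <=
    gap L c eps (2 * G) j b t by exact: H.
elim: t => [|t IH] tT; first by rewrite subrr norm2_0.
have {}IH := IH (ltnW tT).
have e0 : 0 <= c / t.+1%:R :> R by rewrite divr_ge0// ltW.
rewrite /= etaE//.
set u := sgd_path l eps eta w0 x t in IH *.
set v := sgd_path l eps eta w0 y t in IH *.
case: ifPn => [_|bj]; first by rewrite (le_trans (sgd_step_dist_le lA _ _ _ _ _
  e0))// lerD2r.
have -> : y t = x t by rewrite /y (negbTE bj).
case: ifPn => [_|us].
  rewrite minr_pMr// addr_minr le_min; apply/andP; split.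
    rewrite (le_trans (sgd_step_same_dist_le lA _ _ _ e0 eps0))// lerD//.
    by rewrite ler_wpM2l// lerD2r ler_wpM2l// ltW.
  by rewrite (le_trans (sgd_step_dist_le lA _ _ _ _ _ e0))// lerD2r.
(* A zero gap forces equal iterates, and the same example then produces the same step, truncated or
   not. *)
have -> : u = v.
  apply/eqP; rewrite -subr_eq0; apply/eqP; apply: norm2_eq0; apply/eqP.
  by rewrite eq_le norm2_ge0 andbT -(gap_unselected L c eps (2 * G) us).
by rewrite subrr norm2_0.
Qed.

End path_gap.

(** * Generalization error *)

Section population.
Context {R : realType} {p : nat} {d : measure_display} {Z : measurableType d}.
Variables (P : probability Z R) (l : 'rV[R]_p -> Z -> R) (G L lstar : R).
Hypothesis lA : loss_assumptions l G L lstar.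

Let ml w : measurable_fun [set: Z] (l w).
Proof. by case: lA. Qed.

Lemma loss_diff_integrable w w' :
  P.-integrable [set: Z] (EFin \o (fun z => l w z - l w' z)).
Proof.
apply: (bounded_integrable (M := G * norm2 (w - w'))).
  exact: measurable_funB.
by move=> z; exact: (loss_lipschitz lA).
Qed.

(** Losses at two points differ by a bounded function of z, so integrability holds at every point or
    at none. *)
Lemma loss_integrable_all w w' : P.-integrable [set: Z] (EFin \o l w) ->
  P.-integrable [set: Z] (EFin \o l w').
Proof.
move=> iw; have := integrableD measurableT iw (loss_diff_integrable w' w).
apply: eq_integrable => // z _ /=.
by rewrite -EFinD addrC subrK.
Qed.

Lemma population_loss_EFin w : P.-integrable [set: Z] (EFin \o l w) ->
  population_loss l P w = (\int[P]_z l w z)%:E.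
Proof.
by move=> iw; rewrite /population_loss unlock /Rintegral fineK//
  integrable_fin_num.
Qed.

(** The lower bound [lstar] makes the negative part integrable, so only the positive part can have
    infinite integral. *)
Lemma population_loss_pinfty w : ~ P.-integrable [set: Z] (EFin \o l w) ->
  population_loss l P w = +oo%E.
Proof.
move=> niw; rewrite /population_loss unlock integralE.
have mw : measurable_fun [set: Z] (EFin \o l w) by exact/measurable_EFinP.
have mneg : measurable_fun [set: Z] (EFin \o l w)^\-%E by exact:
  measurable_funeneg.
have mpos : measurable_fun [set: Z] (EFin \o l w)^\+%E by exact:
  measurable_funepos.
have neg_fin : (\int[P]_z (EFin \o l w)^\- z < +oo)%E.
  apply: (@le_lt_trans _ _ (\int[P]_z (cst `|lstar|%:E z))%E).
    apply: ge0_le_integral => //.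
    - move=> z _; rewrite funenegE/= -EFin_max lee_fin ge_max normr_ge0 andbT.
      case: lA => _ _ _ lge _; rewrite (@le_trans _ _ (- lstar))// ?lerN2//.
      by rewrite ler_normr lexx orbT.
  rewrite integral_cst// [X in (_ * X)%E](probability_setT P) mule1.
  exact: ltry.
have [pfin|] := ltP (\int[P]_z (EFin \o l w)^\+ z)%E +oo%E.
  exfalso; apply: niw; apply/integrableP; split => //.
  have -> : (fun z => `|(EFin \o l w) z|)%E =
      ((EFin \o l w)^\+ \+ (EFin \o l w)^\-)%E by rewrite -fune_abse.
  by rewrite ge0_integralD//; exact: lte_add_pinfty.
rewrite leye_eq => /eqP ->.
rewrite addye// -ltNye lteNr.
exact: neg_fin.
Qed.

End population.

(** * Reduction to the centered loss *)

Section reduction.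
Context {R : realType} {p n T' : nat} {d d' : measure_display}
  {Z : measurableType d} {Omega : measurableType d'}.
Let T := T'.+1.
Variables (P : probability Z R) (Pr : probability Omega R).
Variables (S : 'I_n -> {RV Pr >-> Z}) (B : nat -> Omega -> 1.-tuple 'I_n).
Hypothesis smp : tsgd_sampling T P S B.
Variables (l : 'rV[R]_p -> Z -> R) (G L lstar : R).
Hypothesis lA : loss_assumptions l G L lstar.
Variables (eps : R) (eta : nat -> R) (w0 : 'rV[R]_p).
Hypothesis eta0 : forall t, (1 <= t <= T)%N -> 0 <= eta t.
Hypothesis n0 : (0 < n)%N.

(** Subtracting the value at [w0] makes it vanish there, hence bounded along paths; subtracting the
    means makes it centered. *)
Definition centered_loss (w : 'rV[R]_p) (z : Z) : R :=
  l w z - l w0 z - (\int[P]_x l w x - \int[P]_x l w0 x).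

Lemma grad_bound_ge0 : 0 <= G.
Proof.
by case: lA => _ _ lG _ _; exact: le_trans (norm2_ge0 _) (lG point w0).
Qed.

Lemma tsgd_draws (b : {ffun 'I_T -> 'I_n}) w : draws B b w ->
  tsgd l eps eta w0 (S^~ w) (fun t => B t w) T = draw_path S l eps eta w0 b w.
Proof.
move=> bw; apply: (@tsgd_singletons _ _ _ _ _ _ _ _ _ _ (fun t => b (inord t)))
  => s sT.
by have := bw (inord s); rewrite inordK// => ->.
Qed.

Lemma sum_draws (f : {ffun 'I_T -> 'I_n} -> R) b w :
  draws B b w ->
  \sum_b' \1_(draws B b') w * f b' = f b.
Proof.
move=> bw; have [b1 b1w uniq1] := draws_partition (T := T) B w.
have bb1 : b = b1 by apply/eqP; apply: contrapT => /negP /uniq1.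
rewrite bb1 (bigD1 b1)//= big1 ?addr0 => [|b' b'1].
  by rewrite indicE mem_set ?mul1r.
by rewrite indicE memNset ?mul0r//; exact: uniq1.
Qed.

Hypothesis il : P.-integrable [set: Z] (EFin \o l w0).

Let ilw w : P.-integrable [set: Z] (EFin \o l w).
Proof. exact: (loss_integrable_all lA w il). Qed.

Lemma centered_loss_measurable w : measurable_fun [set: Z] (centered_loss w).
Proof.
case: lA => ml _ _ _ _; apply: measurable_funB; last exact: measurable_cst.
exact: measurable_funB.
Qed.

Lemma centered_loss_lipschitz z w w' :
  `|centered_loss w z - centered_loss w' z| <= 2 * G * norm2 (w - w').
Proof.
have -> : centered_loss w z - centered_loss w' z =
    (l w z - l w' z) - (\int[P]_x l w x - \int[P]_x l w' x).
  by rewrite /centered_loss; ring.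
rewrite (le_trans (ler_normB _ _))// -mulrA mulrDl mul1r lerD//.
  exact: (loss_lipschitz lA).
rewrite -RintegralB//; apply: Rintegral_norm_le.
  by case: lA => ml _ _ _ _; exact: measurable_funB.
by move=> x; exact: (loss_lipschitz lA).
Qed.

Lemma centered_loss_w0 z : centered_loss w0 z = 0.
Proof. by rewrite /centered_loss !subrr. Qed.

Lemma centered_loss_mean w : \int[P]_z centered_loss w z = 0.
Proof.
have ic (x : R) : P.-integrable [set: Z] (EFin \o cst x).
  exact: (bounded_integrable (M := `|x|)).
have idw := loss_diff_integrable P lA w w0.
rewrite /centered_loss (RintegralB measurableT idw (ic _)).
by rewrite RintegralB// [X in _ - X]Rintegral_cst_probability subrr.
Qed.

Let h := centered_loss.
Let W w := tsgd l eps eta w0 (S^~ w) (fun t => B t w) T.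

Lemma example_loss_integral (i : 'I_n) :
  Pr.-integrable [set: Omega] (EFin \o (fun w => l w0 (S i w))) /\
  \int[Pr]_w l w0 (S i w) = \int[P]_z l w0 z.
Proof.
have mP A : measurable A -> pushforward Pr (S i) A = P A.
  by case: smp => h1 _ _; exact: h1.
have ml : measurable_fun [set: Z] (EFin \o l w0).
  by apply/measurable_EFinP; case: lA.
have mS : measurable_fun [set: Omega] (S i) by exact: measurable_funPT.
have iS : Pr.-integrable [set: Omega] ((EFin \o l w0) \o S i).
  apply/integrableP; split; first exact: measurableT_comp.
  have mabs : measurable_fun [set: Z] (fun z => `|(EFin \o l w0) z|)%E.
    exact: measurableT_comp.
  have := ge0_integral_pushforward mS Pr measurableT mabs (fun=> fun=> abse_ge0
    _).
  rewrite preimage_setT => <-.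
  rewrite (eq_measure_integral P); last by move=> A mA _; exact: mP.
  by case/integrableP : il.
split => //; congr fine.
have E := integral_pushforward (D := setT) mS ml iS measurableT.
rewrite preimage_setT in E; rewrite -[LHS]E.
by apply: eq_measure_integral => A mA _; exact: mP.
Qed.

(** Centering removes from the integrand only the empirical fluctuation of the loss at [w0], whose
    mean is 0. The draw events partition [Omega], and on each of them the run is the corresponding
    [draw_path]. *)
Lemma err_gen_centered :
  err_gen l P Pr S W = (n%:R^-1 * \sum_(i < n) \sum_(b : {ffun 'I_T -> 'I_n})
    \int[Pr]_w (\1_(draws B b) w * h (draw_path S l eps eta w0 b w) (S i
      w)))%:E.
Proof.
rewrite /err_gen.
pose K := 2 * G.
have K0 : 0 <= K by rewrite mulr_ge0// grad_bound_ge0.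
pose f i (b : {ffun 'I_T -> 'I_n}) w := \1_(draws B b) w * h (draw_path S l eps
  eta w0 b w) (S i w).
have if_ i b : Pr.-integrable [set: Omega] (EFin \o f i b).
  apply: (bounded_integrable (M := K * (G * \sum_(1 <= s < T.+1) eta s))).
    exact: (draw_loss_measurable smp lA eps eta w0 centered_loss_measurable
      centered_loss_lipschitz).
  exact: (draw_loss_norm_le S B lA eps eta0 K0 centered_loss_lipschitz
    centered_loss_w0).
pose g i w := l w0 (S i w) - \int[P]_z l w0 z.
have ic (x : R) : Pr.-integrable [set: Omega] (EFin \o cst x).
  exact: (bounded_integrable (M := `|x|)).
have ig i : Pr.-integrable [set: Omega] (EFin \o g i).
  exact: (integrableB measurableT (example_loss_integral i).1 (ic _)).
have g0 i : \int[Pr]_w g i w = 0.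
  rewrite (RintegralB measurableT (example_loss_integral i).1 (ic _)).
  by rewrite (example_loss_integral i).2 [X in _ - X]Rintegral_cst_probability
    subrr.
pose F w := n%:R^-1 * \sum_i \sum_b f i b w + n%:R^-1 * \sum_i g i w.
have FE w : ((empirical_loss l (S^~ w) (W w))%:E - population_loss l P (W w) =
    (F w)%:E)%E.
  rewrite population_loss_EFin// -EFinB; congr EFin.
  have [b bw _] := draws_partition (T := T) B w.
  have fE i : \sum_b f i b w = h (W w) (S i w).
    by rewrite (sum_draws _ bw) /W (tsgd_draws bw).
  rewrite /F /empirical_loss -mulrDr -big_split/=.
  have -> : \int[P]_z l (W w) z = n%:R^-1 * \sum_(i < n) \int[P]_z l (W w) z.
    by rewrite sumr_const card_ord -(mulr_natl (\int[P]_z l (W w) z)) mulKf//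
      pnatr_eq0 -lt0n.
  rewrite -mulrBr -sumrB; congr (_ * _); apply: eq_bigr => i _.
  by rewrite fE /h /centered_loss /g; ring.
under eq_integral do rewrite FE.
have [s1 i1] := Rintegral_seq_sum (index_enum 'I_n)
  (fun i => (Rintegral_seq_sum (index_enum {ffun 'I_T -> 'I_n}) (if_ i)).2).
have [s2 i2] := Rintegral_seq_sum (index_enum 'I_n) ig.
have i1' := integrableZl measurableT n%:R^-1 i1.
have i2' := integrableZl measurableT n%:R^-1 i2.
have iF : Pr.-integrable [set: Omega] (EFin \o F).
  exact: (integrableD measurableT i1' i2').
rewrite -[LHS]fineK; last exact: integrable_fin_num.
congr EFin.
transitivity (\int[Pr]_w F w) => //.
rewrite /F RintegralD// RintegralZl// RintegralZl// s1 s2.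
rewrite [X in _ + _ * X]big1 ?mulr0 ?addr0//.
congr (_ * _); apply: eq_bigr => i _.
by rewrite (Rintegral_seq_sum _ (if_ i)).1.
Qed.

End reduction.

(** * The two step-size regimes *)

Section bounds.
Context {R : realType} {p n T' : nat} {d d' : measure_display}
  {Z : measurableType d} {Omega : measurableType d'}.
Let T := T'.+1.
Variables (P : probability Z R) (Pr : probability Omega R).
Variables (S : 'I_n -> {RV Pr >-> Z}) (B : nat -> Omega -> 1.-tuple 'I_n).
Hypothesis smp : tsgd_sampling T P S B.
Variables (l : 'rV[R]_p -> Z -> R) (G L lstar : R).
Hypothesis lA : loss_assumptions l G L lstar.
Variables (eps c : R) (eta : nat -> R) (w0 : 'rV[R]_p).
Hypotheses (n0 : (0 < n)%N) (c0 : 0 < c).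
Hypothesis il : P.-integrable [set: Z] (EFin \o l w0).

Let prb : R := (n%:R ^+ T)^-1.
Let E (b : {ffun 'I_T -> 'I_n}) (i : 'I_n) : R := \int[Pr]_w
  (\1_(draws B b) w *
   centered_loss P l w0 (draw_path S l eps eta w0 b w) (S i w)).

Let G0 : 0 <= G. Proof. exact: (grad_bound_ge0 lA w0). Qed.

Let KG0 : 0 <= 2 * G. Proof. by rewrite mulr_ge0. Qed.

Let draw_loo (eta0 : forall t, (1 <= t <= T)%N -> 0 <= eta t) b i D :
  (forall w, norm2 (draw_path S l eps eta w0 b w - draw_path_but S l eps eta w0
    b i w) <= D) ->
  E b i <= prb * (2 * G * D).
Proof.
exact: (leave_one_out smp lA eta0 KG0 (centered_loss_measurable P lA w0)
  (centered_loss_lipschitz lA il) (centered_loss_w0 P l w0)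
  (centered_loss_mean lA il)).
Qed.

(** The constant of [sampled_deviation], with its moment order q + 1 = 2p + 2 written out. *)
Definition chaining_constant : R :=
  4 * (1 + 2 * expR 1 * ((2 * p).+2)`!%:R * 2 ^+ p) + 1.

Lemma chaining_constant_ge0 : 0 <= chaining_constant.
Proof.
by rewrite !(addr_ge0, mulr_ge0) ?exprn_ge0 ?expR_ge0 ?ler0n.
Qed.

Lemma draw_sum_le_inverse_sqrt b :
  (forall t, (1 <= t <= T)%N -> 0 <= eta t <= c / Num.sqrt T%:R) ->
  \sum_i E b i <= prb * (chaining_constant * (2 * p.+1%:R * c) * (G ^+ 2 *
    T%:R)).
Proof.
move=> etac.
have eta0 t : (1 <= t <= T)%N -> 0 <= eta t by move=> /etac /andP[].
have sT0 : 0 < Num.sqrt T%:R :> R by rewrite sqrtr_gt0 ltr0n.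
have prb0 : 0 <= prb by rewrite invr_ge0 exprn_ge0.
have sumeta : \sum_(1 <= s < T.+1) eta s <= c * Num.sqrt T%:R.
  apply: (@le_trans _ _ (\sum_(1 <= s < T.+1) c / Num.sqrt T%:R)).
    rewrite big_nat [leRHS]big_nat; apply: ler_sum => s sT.
    by case/andP: (etac s sT).
  rewrite sumr_const_nat subn1/= -(mulr_natl (c / _)).
  have TE : T%:R = Num.sqrt T%:R ^+ 2 :> R by rewrite sqr_sqrtr ?ler0n.
  rewrite [X in X * _ <= _]TE le_eqVlt; apply/orP; left; apply/eqP.
  by field; rewrite lt0r_neq0.
(* Chaining needs a positive Lipschitz constant and radius. For G = 0 the leave-one-out bound
   vanishes for any distance between the paths. *)
have [G00|Gpos] := eqVneq G 0.
  rewrite [leRHS](_ : _ = 0); last by rewrite G00 expr0n mul0r !mulr0.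
  apply: sumr_le0 => i _.
  pose D := G * \sum_(1 <= s < T.+1) eta s + G * \sum_(1 <= s < T.+1) eta s.
  have -> : 0 = prb * (2 * G * D) by rewrite G00 mulr0 mul0r mulr0.
  apply: draw_loo => // w.
  have -> : draw_path S l eps eta w0 b w - draw_path_but S l eps eta w0 b i w =
      (draw_path S l eps eta w0 b w - w0) - (draw_path_but S l eps eta w0 b i w
        - w0).
    move: (draw_path _ _ _ _ _ _ _) (draw_path_but _ _ _ _ _ _ _ _) => u v.
    by apply/rowP => k; rewrite !mxE; ring.
  rewrite (le_trans (norm2B _ _))// lerD//.
    exact: (draw_path_dist S lA eps w0 eta0).
  exact: (draw_path_but_dist S lA eps w0 eta0).
have {}Gpos : 0 < G by rewrite lt0r Gpos.
pose r := G * (c * Num.sqrt T%:R).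
have r0 : 0 < r by rewrite !mulr_gt0.
have etar : G * \sum_(1 <= s < T.+1) eta s <= r by rewrite ler_wpM2l.
(* The drawn examples, at most T of them, without repetition as the moment bounds require distinct
   ones. *)
pose s := undup (codom b).
have sT : (size s <= T)%N.
  by rewrite (leq_trans (size_undup _))// size_codom card_ord.
have us : uniq s := undup_uniq _.
have K0 : 0 < 2 * G by rewrite mulr_gt0.
have dev := sampled_deviation smp lA eps eta0 K0 (centered_loss_measurable P lA
  w0)
  (centered_loss_lipschitz lA il) (centered_loss_w0 P l w0)
  (centered_loss_mean lA il) b r0 etar us sT.
have iE i : Pr.-integrable [set: Omega] (EFin \o (fun w => \1_(draws B b) w *
    centered_loss P l w0 (draw_path S l eps eta w0 b w) (S i w))).
  apply: (bounded_integrable (M := 2 * G * (G * \sum_(1 <= s < T.+1) eta s))).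
    exact: (draw_loss_measurable smp lA eps eta w0 (centered_loss_measurable P
      lA w0)
      (centered_loss_lipschitz lA il)).
  exact: (draw_loss_norm_le S B lA eps eta0 KG0 (centered_loss_lipschitz lA il)
    (centered_loss_w0 P l w0)).
(* For an example that is not drawn, the path and its leave-one-out version coincide, so its
   contribution is at most 0. *)
rewrite (bigID (mem s))/= -[leRHS]addr0 lerD//; last first.
  apply: sumr_le0 => i is_.
  have -> : 0 = prb * (2 * G * 0) by rewrite !mulr0.
  apply: draw_loo => // w.
  suff -> : draw_path_but S l eps eta w0 b i w = draw_path S l eps eta w0 b w.
    by rewrite subrr norm2_0.
  apply: eq_sgd_path => t _; rewrite ifN//.
  by apply: contraNneq is_ => <-; rewrite mem_undup codom_f.
rewrite -big_uniq//= -(Rintegral_seq_sum s iE).1.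
have dev' : \int[Pr]_w (\sum_(i <- s) \1_(draws B b) w *
    centered_loss P l w0 (draw_path S l eps eta w0 b w) (S i w)) =
  \int[Pr]_w (\1_(draws B b) w * \sum_(i <- s)
    centered_loss P l w0 (draw_path S l eps eta w0 b w) (S i w)).
  by apply: eq_Rintegral => w _; rewrite mulr_sumr.
rewrite dev' (le_trans dev)// ler_wpM2l//.
rewrite -[X in X * _ <= _]/chaining_constant -[leRHS]mulrA.
rewrite ler_wpM2l ?chaining_constant_ge0// /r.
have TE : T%:R = Num.sqrt T%:R ^+ 2 :> R by rewrite sqr_sqrtr ?ler0n.
rewrite [X in _ <= _ * (_ * X)]TE le_eqVlt; apply/orP; left; apply/eqP.
by ring.
Qed.

Lemma err_gen_le_inverse_sqrt :
  (forall t, (1 <= t <= T)%N -> 0 <= eta t <= c / Num.sqrt T%:R) ->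
  (err_gen l P Pr S
     (fun w => tsgd l eps eta w0 (S^~ w) (fun t => B t w) T)
   <= (chaining_constant * (2 * p.+1%:R * c) * (G ^+ 2 * T%:R / n%:R))%:E)%E.
Proof.
move=> etac.
have eta0 t : (1 <= t <= T)%N -> 0 <= eta t by move=> /etac /andP[].
rewrite (err_gen_centered smp lA eps eta0 n0 il) lee_fin exchange_big/=.
set V := chaining_constant * _.
have -> : V * (G ^+ 2 * T%:R / n%:R) = n%:R^-1 * (V * (G ^+ 2 * T%:R)) by ring.
rewrite ler_wpM2l ?invr_ge0//.
rewrite (@le_trans _ _ (\sum_(b : {ffun 'I_T -> 'I_n}) prb * (V * (G ^+ 2 *
  T%:R))))//.
  by apply: ler_sum => b _; exact: draw_sum_le_inverse_sqrt.
by have := avg_cst (T' := T') (V * (G ^+ 2 * T%:R)) n0; rewrite /avg => ->.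
Qed.

(** The factor 4 G^2 is the Lipschitz constant 2G of the centered loss times the bound 2G on the
    distance of two truncated gradients. *)
Lemma err_gen_le_inverse_time (c' : R) :
  0 < L -> 0 <= eps -> eps <= c' / n%:R ->
  (forall t, (1 <= t <= T)%N -> eta t = c / t%:R) ->
  (err_gen l P Pr S
     (fun w => tsgd l eps eta w0 (S^~ w) (fun t => B t w) T)
   <= (4 * ((2 * c + (c' + 1) / L) / (1 - 2^-1 `^ (1 - 1 / (L * c + 1)))) *
       (G ^+ 2 * (T%:R `^ (1 - 1 / (L * c + 1))) / n%:R))%:E)%E.
Proof.
move=> L0 eps0 epsc etaE.
have eta0 t : (1 <= t <= T)%N -> 0 <= eta t.
  by move=> tT; rewrite etaE// divr_ge0// ltW.
rewrite (err_gen_centered smp lA eps eta0 n0 il) lee_fin.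
set q := 1 - 1 / _; set C := (2 * c + (c' + 1) / L) / (1 - 2^-1 `^ q).
have -> : 4 * C * (G ^+ 2 * T%:R `^ q / n%:R) =
    n%:R^-1 * \sum_(i < n) (2 * G * (C * (2 * G / n%:R) * T%:R `^ q)).
  rewrite sumr_const card_ord -(mulr_natl (2 * G * _)) mulKf ?pnatr_eq0
    -?lt0n//.
  by ring.
rewrite ler_wpM2l ?invr_ge0//; apply: ler_sum => i _.
apply: (@le_trans _ _ (\sum_(b : {ffun 'I_T -> 'I_n})
    prb * (2 * G * gap L c eps (2 * G) i b T))).
  apply: ler_sum => b _; apply: draw_loo => // w.
  exact: (draw_path_dist_le_gap S lA (c := c)).
have -> : \sum_(b : {ffun 'I_T -> 'I_n}) prb * (2 * G * gap L c eps (2 * G) i b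
  T) =
    2 * G * avg (fun b : {ffun 'I_T -> 'I_n} => gap L c eps (2 * G) i b T).
  by rewrite -avgZ.
rewrite ler_wpM2l//.
exact: (avg_gap_le i L0 c0 eps0 KG0 epsc).
Qed.

End bounds.

(** The first constant is chosen after [p], since nets in R^p enter it; the second comes from
    stability alone and serves all dimensions. *)
Theorem corollary1 (R : realType) (L c c' : R) (L_gt0 : 0 < L) (c_gt0 : 0 < c)
    (c'_gt0 : 0 < c') :
  (forall p : nat, exists C : R,
    forall (d d' : measure_display) (Z : measurableType d)
      (Omega : measurableType d') (P : probability Z R)
      (Pr : probability Omega R) (l : 'rV[R]_p -> Z -> R) (G lstar : R)
      (n T : nat) (S : 'I_n -> {RV Pr >-> Z})
      (B : nat -> Omega -> 1.-tuple 'I_n) (w0 : 'rV[R]_p) (eps : R)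
      (eta : nat -> R),
    loss_assumptions l G L lstar ->
    (0 < n)%N -> (0 < T)%N ->
    tsgd_sampling T P S B ->
    0 <= eps -> eps <= Num.min 1 (c' / n%:R) ->
    (forall t : nat, (1 <= t <= T)%N -> 0 <= eta t <= c / Num.sqrt T%:R) ->
    (err_gen l P Pr S
       (fun omega => tsgd l eps eta w0 (S^~ omega) (fun t => B t omega) T)
     <= (C * (G ^+ 2 * T%:R / n%:R))%:E)%E)
  /\
  (exists C : R,
    forall (p : nat) (d d' : measure_display) (Z : measurableType d)
      (Omega : measurableType d') (P : probability Z R)
      (Pr : probability Omega R) (l : 'rV[R]_p -> Z -> R) (G lstar : R)
      (n T : nat) (S : 'I_n -> {RV Pr >-> Z})
      (B : nat -> Omega -> 1.-tuple 'I_n) (w0 : 'rV[R]_p) (eps : R)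
      (eta : nat -> R),
    loss_assumptions l G L lstar ->
    (0 < n)%N -> (0 < T)%N ->
    tsgd_sampling T P S B ->
    0 <= eps -> eps <= Num.min 1 (c' / n%:R) ->
    (forall t : nat, (1 <= t <= T)%N -> eta t = c / t%:R) ->
    (err_gen l P Pr S
       (fun omega => tsgd l eps eta w0 (S^~ omega) (fun t => B t omega) T)
     <= (C * (G ^+ 2 * (T%:R `^ (1 - 1 / (L * c + 1))) / n%:R))%:E)%E).
Proof.
(* Without integrability at [w0] the integrand is -oo everywhere, and the bounds hold trivially. *)
have infinite_case p d d' (Z : measurableType d) (Omega : measurableType d')
    (P : probability Z R) (Pr : probability Omega R) (l : 'rV[R]_p -> Z -> R)
    (G lstar : R) n (S : 'I_n -> Omega -> Z) (W : Omega -> 'rV[R]_p) w0 :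
    loss_assumptions l G L lstar -> ~ P.-integrable [set: Z] (EFin \o l w0) ->
    err_gen l P Pr S W = -oo%E.
  move=> lA nil.
  have Poo w : population_loss l P w = +oo%E.
    apply: (population_loss_pinfty lA) => iw; apply: nil.
    exact: (loss_integrable_all lA _ iw).
  rewrite /err_gen; under eq_integral do rewrite Poo addeNy.
  by rewrite integral_cst// [X in (_ * X)%E](probability_setT Pr) mule1.
split=> [p|].
  exists (@chaining_constant R p * (2 * p.+1%:R * c)).
  move=> d d' Z Omega P Pr l G lstar n [//|T'] S B w0 eps eta lA n0 _ smp _ _
    etac.
  have [il|nil] := pselect (P.-integrable [set: Z] (EFin \o l w0)).
    exact: (err_gen_le_inverse_sqrt smp lA).
  by rewrite (infinite_case _ _ _ _ _ _ _ _ _ _ _ _ _ _ lA nil) leNye.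
exists (4 * ((2 * c + (c' + 1) / L) / (1 - 2^-1 `^ (1 - 1 / (L * c + 1))))).
move=> p d d' Z Omega P Pr l G lstar n [//|T'] S B w0 eps eta lA n0 _ smp.
move=> eps0; rewrite le_min => /andP[_ epsc] etaE.
have [il|nil] := pselect (P.-integrable [set: Z] (EFin \o l w0)).
  exact: (err_gen_le_inverse_time smp lA n0 c_gt0 il L_gt0 eps0 epsc etaE).
by rewrite (infinite_case _ _ _ _ _ _ _ _ _ _ _ _ _ _ lA nil) leNye.
Qed.
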